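(* Let $s,r,n\in\mathbb N$ with $n\ge s$ and $r\ge2$, and let $p,q,R,R',\eta\in\mathbb R$ satisfy $$0<q<\tfrac18,\quad 0<p\le\frac q{2^{10}r^2s^2},\quad R=2^{-6}pn,\quad 0\le R'\le\frac R{16},\quad \eta=p^4\Big(\frac q2\Big)^{4s}.$$ Let $\mathcal F$ be a $(p,R')$-Janson $(s+1)$-uniform hypergraph with vertex set $U$, let $\mathcal H$ be an $s$-uniform hypergraph with vertex set $V$, $|V|=n$, and let $\pi:V\to U$ satisfy $|\pi(L)|\ge|L|/2$ for every $L\subset V$ and $|\pi(E)|=|E|$ for every $E\in\mathcal H$. Let $v$ be a vertex not in $U$. Then there is a family $\mathcal X\subset2^V$ with $|\mathcal X|\le4(2/q)^{4qn}$ such that: (1) if $I\subset V$ and $\pi_v(\mathcal H[I])\cup\mathcal F$ is not $(p,R'+\eta R)$-Janson, then $I\subset X$ for some $X\in\mathcal X$; (2) for each $X\in\mathcal X$ with $|X|\ge n/(8r)$ there exists $Y\subset X$ with $|Y|\ge|X|-2^{-8}r^{-1}n$ such that $\pi(\mathcal H[Y])$ is not $(p,R)$-Janson.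
   Context: A hypergraph is identified with its edge set; $\mathcal H[I]=\{E\in\mathcal H:E\subset I\}$. For a hypergraph $\mathcal G$ on $V$, $\pi(\mathcal G)=\{\pi(E):E\in\mathcal G\}$ and $\pi_v(\mathcal G)=\{\pi(E)\cup\{v\}:E\in\mathcal G\}$; the union of two hypergraphs is the hypergraph on the union of their vertex sets whose edge set is the union of their edge sets. For $\nu:\mathcal G\to\mathbb R_{\ge0}$: $e(\nu)=\sum_E\nu(E)$, $d_\nu(L)=\sum_{E\in\mathcal G,L\subset E}\nu(E)$, $\Lambda_p(\nu)=\sum_{L\subset V(\mathcal G),|L|\ge2}d_\nu(L)^2p^{-|L|}$. For $R>0$, $\mathcal G$ is $(p,R)$-Janson if some $\nu:\mathcal G\to\mathbb R_{\ge0}$ has $\Lambda_p(\nu)<e(\nu)^2/R$; every hypergraph is $(p,0)$-Janson. *)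

(* Defs.v *)
From HB Require Import structures.
From mathcomp Require Import all_boot all_order all_algebra.
From mathcomp Require Import all_classical all_reals all_analysis.
Set Implicit Arguments. Unset Strict Implicit. Unset Printing Implicit Defensive.
Import Order.TTheory GRing.Theory Num.Theory.
Local Open Scope ring_scope.

(* A hypergraph on a finite ambient type T is identified with its edge set. *)
Definition uniform (T : finType) (k : nat) (G : {set {set T}}) : Prop :=
  forall E, E \in G -> #|E| = k.

Definition sub_hgraph (T : finType) (G : {set {set T}}) (I : {set T}) : {set {set T}} :=
  [set E in G | E \subset I].

Definition hproj (V T : finType) (pi : V -> T) (G : {set {set V}}) : {set {set T}} :=
  [set (pi @: E) | E : {set V} in G].

Definition hproj_v (V T : finType) (pi : V -> T) (v : T) (G : {set {set V}})
  : {set {set T}} := [set v |: (pi @: E) | E : {set V} in G].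

Section Janson.
Variables (R : realType) (T : finType).

Definition e_nu (G : {set {set T}}) (nu : {set T} -> R) : R :=
  \sum_(E in G) nu E.

Definition d_nu (G : {set {set T}}) (nu : {set T} -> R) (L : {set T}) : R :=
  \sum_(E in G | L \subset E) nu E.

(* Lambda_p(nu); sets L not contained in any edge have d_nu(L) = 0, so summing
   over all L of the ambient type with |L| >= 2 equals summing over L in V(G). *)
Definition Lambda (p : R) (G : {set {set T}}) (nu : {set T} -> R) : R :=
  \sum_(L : {set T} | (2 <= #|L|)%N) (d_nu G nu L) ^+ 2 * p ^- #|L|.

Definition janson (p Rj : R) (G : {set {set T}}) : Prop :=
  Rj = 0 \/
  (0 < Rj /\ exists nu : {set T} -> R,
     (forall E, 0 <= nu E) /\ Lambda p G nu < (e_nu G nu) ^+ 2 / Rj).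
End Janson.

(* Main.v *)
Require Import Defs.
From HB Require Import structures.
From mathcomp Require Import all_boot all_order all_algebra.
From mathcomp Require Import all_classical all_reals all_analysis.
From mathcomp Require Import fintype finset ring lra zify.

(** Call a set I bad if the hypergraph in part (1) is not Janson; bad sets form a
    down-set D.  For a down-set D, a set S and a density t, let Z_t(S) be the
    probability that a t-random set containing S lies in D.  As long as some L has
    S :|: L in D but Z_t(S :|: L) markedly smaller than Z_t(S), ask whether L is
    contained in I: if so, L joins the fingerprint S, which makes Z_t drop; if not,
    the supersets of L are removed from D, which is free.  Since Z_t(S) is at least
    (1 - t)^n, the fingerprint stays small, and it determines the whole history.
    Two densities are used at once: at density q all L are tested, with a loss of
    1/4 per vertex; at density q/(16 s^2) only single vertices are tested, with a
    loss of 1/(16 s^2).  The container is the set X of vertices not excluded.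

    If all large subsets Y of X were Janson, an average of Janson measures that
    avoid each other's heavy vertices would give a Janson measure nu on X with small
    vertex degrees, and half of nu lives on edges whose mixed term with the measure
    of F is small.  An edge E with S :|: E still in D is contained in the random set
    of density q with probability at least (q/4)^s; if such edges carry a quarter of
    nu, some bad set contains enough of nu to contradict its badness.  Otherwise the
    edges with S :|: E outside D carry more than a quarter of nu.  Adding the vertices
    of such an edge one by one brings Z_t from Z_t(S) down to 0, so the edges push
    many pairs (random set, vertex) out of D, whereas the second moment method and
    the stability of single vertices bound the number of such pairs. *)

Set Implicit Arguments. Unset Strict Implicit. Unset Printing Implicit Defensive.
Import Order.TTheory GRing.Theory Num.Theory.
Local Open Scope ring_scope.

(** * Random supersets of a fingerprint and their survival probability *)

Section Survival.
Variables (R : realFieldType) (V : finType).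
Implicit Types (t : R) (S L A B E I : {set V}) (D : {set {set V}}) (y : V).

Definition downset D := forall A B, B \in D -> A \subset B -> A \in D.

(* Probability that a random set containing S, and each other vertex
   independently with probability t, equals A. *)
Definition samp_weight t S A : R := t ^+ #|A :\: S| * (1 - t) ^+ #|~: A|.

(* Probability that this random set belongs to D. *)
Definition survival t D S : R := \sum_(A in D | S \subset A) samp_weight t S A.

Lemma samp_weight_ge0 t S A : 0 <= t <= 1 -> 0 <= samp_weight t S A.
Proof. by case/andP=> t0 t1; rewrite mulr_ge0 // exprn_ge0 // subr_ge0. Qed.

Lemma survival_ge0 t D S : 0 <= t <= 1 -> 0 <= survival t D S.
Proof. by move=> t01; apply: sumr_ge0 => A _; apply: samp_weight_ge0. Qed.

(** The factor [t ^+ #|L :\: S|] is the probability that the random set contains [L]; conditioned on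
    this event it becomes the random set that starts from [L :|: S]. *)
Lemma samp_weightU t S L A : L :|: S \subset A ->
  samp_weight t S A = t ^+ #|L :\: S| * samp_weight t (L :|: S) A.
Proof.
move=> sA; rewrite /samp_weight mulrA -exprD; congr (_ ^+ _ * _).
rewrite -(cardsID L (A :\: S)); congr (_ + _)%N; apply: eq_card => x; rewrite !inE.
  have: x \in L :|: S -> x \in A by apply/subsetP.
  by rewrite inE; case: (x \in L); case: (x \in S); case: (x \in A) => //= ->.
by case: (x \in L); case: (x \in S); case: (x \in A).
Qed.

Lemma survival_sub t D D' S : 0 <= t <= 1 -> D' \subset D ->
  survival t D' S <= survival t D S.
Proof.
move=> t01 sD; rewrite /survival [leRHS](bigID [in D']) /= -[leLHS]addr0.
rewrite lerD //.
  rewrite le_eqVlt; apply/orP; left; apply/eqP/eq_bigl => A.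
  by case: (boolP (A \in D')) => [/(subsetP sD) -> //|]; rewrite ?andbF ?andbT.
by apply: sumr_ge0 => A _; apply: samp_weight_ge0.
Qed.

(** The single outcome [A = S] has at least this probability. This floor is what limits how often
    survival can drop, hence the size of the fingerprint. *)
Lemma survival_ge t D S : 0 <= t <= 1 -> S \in D -> (1 - t) ^+ #|V| <= survival t D S.
Proof.
move=> t01 SD; rewrite /survival (bigD1 S) ?SD ?subxx //=.
apply: (@le_trans _ _ (samp_weight t S S)).
  rewrite /samp_weight setDv cards0 expr0 mul1r.
  by case/andP: t01 => t0 t1; rewrite ler_wiXn2l ?subr_ge0 ?gerBl ?max_card.
by rewrite lerDl; apply: sumr_ge0 => A _; apply: samp_weight_ge0.
Qed.

Lemma sum_subsets_binomial (a b : R) :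
  \sum_(A : {set V}) a ^+ #|A| * b ^+ #|~: A| = (a + b) ^+ #|V|.
Proof.
have -> : (a + b) ^+ #|V| = \prod_(i : V) (a + b) by rewrite big_const -Monoid.iteropE.
rewrite bigA_distr; apply: eq_bigr => A _.
rewrite (bigID [in A]) /=; congr (_ * _).
  rewrite (eq_bigr (fun=> a)); last by move=> i ->.
  by rewrite big_const -Monoid.iteropE.
rewrite (eq_bigr (fun=> b)); last by move=> i /negbTE ->.
rewrite big_const -Monoid.iteropE; congr (_ ^+ _); apply: eq_card => i.
by rewrite inE.
Qed.

Lemma survival0_le1 t D : 0 <= t <= 1 -> survival t D set0 <= 1.
Proof.
move=> t01; apply: le_trans (survival_sub _ t01 (subsetT D)) _.
rewrite /survival (eq_bigl xpredT); last by move=> A; rewrite inE sub0set.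
rewrite (eq_bigr (fun A : {set V} => t ^+ #|A| * (1 - t) ^+ #|~: A|)).
  by rewrite sum_subsets_binomial subrKC expr1n.
by move=> A _; rewrite /samp_weight setD0.
Qed.

(* The loss of survival caused by forcing y is carried by the sets A of D that
   y pushes out of D: toggling y matches all the others in pairs. *)
Lemma survival_drop t D S y : downset D ->
  survival t D S - survival t D (y |: S) =
  \sum_(A in D | (S \subset A) && (y |: A \notin D)) samp_weight t S A.
Proof.
move=> dD; have [yS|yS] := boolP (y \in S).
  rewrite (setUidPr _) ?sub1set // subrr big1 // => A /and3P[AD SA].
  by rewrite (setUidPr _) ?AD // sub1set (subsetP SA).
apply/eqP; rewrite subr_eq; apply/eqP.
rewrite {1}/survival (bigID (fun A => y |: A \notin D)) /=.
congr (_ + _); first by apply: eq_bigl => A; rewrite andbA.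
rewrite (bigID (fun A => y \in A)) /=.
have -> : \sum_(A | ((A \in D) && (S \subset A) && ~~ (y |: A \notin D)) && (y \in A))
    samp_weight t S A = t * survival t D (y |: S).
  rewrite /survival mulr_sumr; apply: eq_big => [A|A].
    rewrite negbK subUset sub1set; case: (boolP (y \in A)) => yA; last by rewrite !andbF.
    by rewrite (setUidPr _) ?sub1set //; case: (A \in D); case: (S \subset A).
  rewrite negbK => /andP[/andP[/andP[AD SA] _] yA].
  rewrite (@samp_weightU t S [set y] A) ?subUset ?sub1set ?yA //.
  by rewrite (setDidPl _) ?disjoints1 ?cards1 ?expr1.
have -> : \sum_(A | ((A \in D) && (S \subset A) && ~~ (y |: A \notin D)) && (y \notin A))
    samp_weight t S A = (1 - t) * survival t D (y |: S).
  rewrite /survival mulr_sumr.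
  rewrite [RHS](reindex_onto (fun A => y |: A) (fun A => A :\ y)) /=; last first.
    by move=> A /andP[_ sA]; rewrite setD1K // (subsetP sA) ?setU11.
  apply: eq_big => [A|A].
    rewrite negbK subUset sub1set setU11 /=.
    have -> : ((y |: A) :\ y == A) = (y \notin A).
      apply/eqP/idP => [<-|yA]; first by rewrite !inE eqxx.
      by rewrite setU1K.
    case: (boolP (y \in A)) => yA; rewrite ?andbF // !andbT.
    have -> : (S \subset y |: A) = (S \subset A).
      by rewrite -subDset (setDidPl _) // disjoint_sym disjoints1.
    case: (boolP (y |: A \in D)) => yAD; rewrite ?andbF ?andbT //=.
    by rewrite (dD _ _ yAD) ?subsetUr.
  case/andP=> /andP[/andP[AD SA] _] yA.
  rewrite /samp_weight mulrCA -exprS; congr (_ ^+ _ * _ ^+ _).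
    apply: eq_card => x; rewrite !inE.
    by case: eqP => [->|] //=; rewrite (negbTE yA) andbF.
  rewrite (cardsD1 y) inE yA; congr _.+1; apply: eq_card => x.
  by rewrite !inE negb_or.
by rewrite -mulrDl subrKC mul1r.
Qed.

End Survival.

(** * First and second moments under the survival measure *)

Section SurvivalMoments.
Variables (R : realFieldType) (V : finType).
Implicit Types (t : R) (S L A B E I : {set V}) (D G : {set {set V}}) (y : V).

(** The vertices of [L] are forced one at a time; by [survival_drop] each loss is a sum of
    nonnegative weights. *)
Lemma survival_antitone t D S L : 0 <= t <= 1 -> downset D ->
  survival t D (L :|: S) <= survival t D S.
Proof.
move=> t01 dD; have [m] := ubnP #|L|; elim: m L => // m IH L.
have [->|[x xL]] := set_0Vmem L; first by rewrite set0U.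
rewrite (cardsD1 x) xL add1n ltnS => /IH; apply: le_trans.
rewrite -{1}(setD1K xL) -setUA -subr_ge0 survival_drop //.
by apply: sumr_ge0 => A _; apply: samp_weight_ge0.
Qed.

Lemma survival_notin t D S : downset D -> S \notin D -> survival t D S = 0.
Proof.
by move=> dD SD; apply: big1 => A /andP[AD /(dD _ _ AD)]; rewrite (negbTE SD).
Qed.

Lemma survival_cond t D S L :
  \sum_(A in D | S \subset A) samp_weight t S A * (L \subset A)%:R =
  t ^+ #|L :\: S| * survival t D (L :|: S).
Proof.
rewrite /survival mulr_sumr (bigID (fun A => L \subset A)) /= [X in _ + X]big1 ?addr0.
  apply: eq_big => [A|A /andP[/andP[AD SA] LA]]; first by rewrite subUset -andbA;
    congr (_ && _); rewrite andbC.
  by rewrite LA mulr1 -samp_weightU // subUset LA.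
by move=> A /andP[_ /negbTE ->]; rewrite mulr0.
Qed.

Definition prefix_set E y := [set x in E | (enum_rank x < enum_rank y)%N].

(** Induction removing the last vertex of [E] in the enumeration: its prefix is the rest of [E], and
    the prefixes of the other vertices do not change. *)
Lemma prefix_set_telescope (g : {set V} -> R) E :
  g set0 - g E = \sum_(y in E) (g (prefix_set E y) - g (y |: prefix_set E y)).
Proof.
have [m] := ubnP #|E|; elim: m E => // m IH E.
have [->|[x0 x0E]] := set_0Vmem E; first by rewrite big_set0 subrr.
have [x xE xmax] := arg_maxnP (fun x => nat_of_ord (enum_rank x)) x0E;
  rewrite -/(x \in E) in xE.
have {}xmax z : z \in E -> (enum_rank z <= enum_rank x)%N by apply: xmax.
rewrite (cardsD1 x) xE add1n ltnS => /IH IHx.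
have prex : prefix_set E x = E :\ x.
  apply/setP=> z; rewrite !inE andbC; case: (boolP (z \in E)) => zE;
    rewrite ?andbF ?andbT //.
  by rewrite ltn_neqAle xmax // andbT (inj_eq val_inj) (inj_eq enum_rank_inj).
rewrite (bigD1 x) //= prex setD1K //.
rewrite -[LHS](subrKA (g (E :\ x))) IHx addrC; congr (_ + _).
apply: eq_big => [z|z /setD1P[zx zE]]; first by rewrite !inE andbC.
suff -> : prefix_set (E :\ x) z = prefix_set E z by [].
apply/setP=> w; rewrite !inE; case: eqP => [->|//] /=.
by rewrite xE /= ltnNge; apply/esym/negbTE; rewrite negbK xmax.
Qed.

Lemma prefix_setD1 E y : prefix_set E y \subset E :\ y.
Proof.
apply/subsetP=> x; rewrite !inE => /andP[xE]; rewrite xE andbT.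
by apply: contraTneq => ->; rewrite ltnn.
Qed.

(** Telescoping along the prefixes of [E]. The term at [y] lives on random sets that start from the
    prefix and [S]; dividing the indicator of the prefix by its probability brings all terms back to
    the one random set that starts from [S]. *)
Lemma survival_drop_edge t D S E : 0 < t -> downset D ->
  survival t D S - survival t D (E :|: S) =
  \sum_(y in E) \sum_(A in D | (S \subset A) && (y |: A \notin D))
    samp_weight t S A * ((prefix_set E y \subset A)%:R * t ^- #|prefix_set E y :\: S|).
Proof.
move=> t0 dD.
rewrite -[in survival t D S](set0U S).
rewrite (prefix_set_telescope (fun L => survival t D (L :|: S))).
apply: eq_bigr => y yE; rewrite -setUA survival_drop //.
set L := prefix_set E y.
rewrite [RHS](bigID (fun A => L \subset A)) /= [X in _ = _ + X]big1 ?addr0; last first.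
  by move=> A /andP[_ /negbTE ->]; rewrite mul0r mulr0.
apply: eq_big => [A|A /and3P[AD sA _]].
  by rewrite subUset -!andbA; case: (A \in D); case: (L \subset A);
    case: (S \subset A) => //=; rewrite ?andbF ?andbT.
rewrite (samp_weightU t sA) (subset_trans _ sA) ?subsetUl // mul1r.
by rewrite mulrAC mulfV ?mul1r // lt0r_neq0 // exprn_gt0.
Qed.

(** After expanding the square, the joint event [pre E :|: pre E' \subset A] contributes [t] to the
    size of the union outside [S], times a survival at most that of [S]. By inclusion-exclusion only
    the power of [t] for the intersection is left over. *)
Lemma survival_second_moment t D S (G : {set {set V}}) (a : {set V} -> R)
    (pre : {set V} -> {set V}) : 0 < t <= 1 -> downset D ->
  (forall E, 0 <= a E) ->
  \sum_(A in D | S \subset A) samp_weight t S A *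
    (\sum_(E in G) a E * ((pre E \subset A)%:R * t ^- #|pre E :\: S|)) ^+ 2 <=
  survival t D S * \sum_(E in G) \sum_(E' in G) a E * a E' * t ^- #|pre E :&: pre E'|.
Proof.
move=> /andP[t0 t1] dD a0.
have t01 : 0 <= t <= 1 by rewrite ltW.
have -> : \sum_(A in D | S \subset A) samp_weight t S A *
    (\sum_(E in G) a E * ((pre E \subset A)%:R * t ^- #|pre E :\: S|)) ^+ 2 =
  \sum_(E in G) \sum_(E' in G) a E * a E' * (t ^- #|pre E :\: S| * t ^- #|pre E' :\: S|)
    * (\sum_(A in D | S \subset A) samp_weight t S A * ((pre E :|: pre E') \subset A)%:R).
  rewrite (eq_bigr (fun A => \sum_(E in G) \sum_(E' in G)
     (a E * a E' * (t ^- #|pre E :\: S| * t ^- #|pre E' :\: S|)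
     * (samp_weight t S A * ((pre E :|: pre E') \subset A)%:R)))); last first.
    move=> A _; rewrite expr2 mulr_suml mulr_sumr; apply: eq_bigr => E _.
    rewrite mulr_sumr mulr_sumr; apply: eq_bigr => E' _.
    by rewrite subUset -mulnb natrM; ring.
  rewrite exchange_big /=; apply: eq_bigr => E _.
  by rewrite exchange_big /=; apply: eq_bigr => E' _; rewrite mulr_sumr.
rewrite mulr_sumr; apply: ler_sum => E _; rewrite mulr_sumr; apply: ler_sum => E' _.
rewrite survival_cond.
set m := #|pre E :\: S|; set m' := #|pre E' :\: S|.
set u := #|(pre E :|: pre E') :\: S|.
have mu : (u + #|(pre E :&: pre E') :\: S| = m + m')%N.
  by rewrite /u setDUl setDIl cardsUI.
have tn0 k : t ^+ k != 0 by rewrite lt0r_neq0 // exprn_gt0.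
rewrite [leRHS]mulrC -!mulrA ler_wpM2l // ler_wpM2l //.
have -> : t ^- m * (t ^- m' * (t ^+ u * survival t D (pre E :|: pre E' :|: S)))
   = t ^- #|(pre E :&: pre E') :\: S| * survival t D (pre E :|: pre E' :|: S).
  rewrite !mulrA -invfM -exprD -mu exprD; congr (_ * _).
  by rewrite invfM mulrAC mulVf // mul1r.
apply: ler_pM => //.
- by rewrite invr_ge0 exprn_ge0 // ltW.
- exact: survival_ge0.
- rewrite lef_pV2 ?posrE ?exprn_gt0 // ler_wiXn2l ?(ltW t0) //.
  by apply: subset_leq_card; apply: subsetDl.
- exact: survival_antitone.
Qed.

End SurvivalMoments.

(** * The container algorithm *)

Section Containers.
Variables (R : realFieldType) (V : finType) (t1 t2 b1 b2 : R).
Hypotheses (t1_01 : 0 <= t1 <= 1) (t2_01 : 0 <= t2 <= 1).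
Hypotheses (b1_01 : 0 <= b1 <= 1) (b2_ge0 : 0 <= b2).
Implicit Types (S L A B E I X : {set V}) (D : {set {set V}}) (y : V).

Definition stable S D :=
  [/\ S \in D,
      forall y, y |: S \in D -> b1 * survival t1 D S <= survival t1 D (y |: S) &
      forall L, L :|: S \in D ->
        b2 ^+ #|L :\: S| * survival t2 D S <= survival t2 D (L :|: S)].

(** [D'] is what remains of [D] after the deletions. As it is a down-set, each of its members that
    contains [S] lies in [X]. *)
Definition is_container D X := exists S D',
  [/\ D' \subset D, downset D', stable S D' & X = [set y | y |: S \in D']].

(** [i] counts the vertices added because of a drop by [b1], and [j] those added because of drops by
    [b2] per vertex. The inequalities squeeze the survival between its floor and the accumulated
    drops. *)
Definition small_fingerprint S := exists i j : nat,
  [/\ (#|S| <= i + j)%N, (1 - t1) ^+ #|V| <= b1 ^+ i & (1 - t2) ^+ #|V| <= b2 ^+ j].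

(* Given a set L violating stability, either I contains L, and L joins the
   fingerprint at the cost of a drop in survival, or L is forbidden for free.
   The final fingerprint S' tells the two cases apart, since S' \subset I. *)
Lemma container_algorithm D S (i j : nat) : downset D ->
  (#|S| <= i + j)%N -> survival t1 D S <= b1 ^+ i -> survival t2 D S <= b2 ^+ j ->
  exists f : {set V} -> {set V}, forall I, I \in D -> S \subset I ->
    exists S', [/\ S \subset S', S' \subset I, small_fingerprint S',
      I \subset f S' & is_container D (f S')].
Proof.
(* Joining [L] to [S] shrinks the complement of [S], forbidding [L] shrinks [D]; either way this sum
   decreases. *)
have [m] := ubnP (#|D| + #|~: S|)%N; elim: m D S i j => // m IH D S i j.
move=> Dm dD Sij s1 s2.
(* No member of [D] contains [S] here, so any function will do. *)
have [SD|SD] := boolP (S \in D); last first.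
  by exists id => I ID SI; case/negP: SD; apply: dD SI.
have branch L i' j' : L :|: S \in D -> ~~ (L \subset S) ->
    (#|L :|: S| <= i' + j')%N -> survival t1 D (L :|: S) <= b1 ^+ i' ->
    survival t2 D (L :|: S) <= b2 ^+ j' ->
    exists f : {set V} -> {set V}, forall I, I \in D -> S \subset I ->
      exists S', [/\ S \subset S', S' \subset I, small_fingerprint S',
      I \subset f S' & is_container D (f S')].
  move=> LSD nLS cij sL1 sL2.
  have [|f1 f1P] := IH D (L :|: S) i' j' _ dD cij sL1 sL2.
    rewrite -ltnS; apply: leq_trans Dm; rewrite ltnS ltn_add2l.
    apply: proper_card; rewrite properC; rewrite properE subsetUr.
    by apply: contra nLS => /(subset_trans (subsetUl L S)).
  pose D' := [set A in D | ~~ (L :|: S \subset A)].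
  have sD' : D' \subset D by apply/subsetP=> A; rewrite inE => /andP[].
  have dD' : downset D'.
    move=> A B; rewrite !inE => /andP[BD nB] sAB; rewrite (dD _ _ BD sAB) /=.
    by apply: contra nB => /subset_trans; apply.
  have [|||f2 f2P] := IH D' S i j _ dD' Sij.
  - rewrite -ltnS; apply: leq_trans Dm; rewrite ltnS ltn_add2r.
    apply: proper_card; rewrite properE sD' /=; apply/subsetPn; exists (L :|: S) => //.
    by rewrite inE subxx andbF.
  - exact: le_trans (survival_sub _ t1_01 sD') s1.
  - exact: le_trans (survival_sub _ t2_01 sD') s2.
  exists (fun T : {set V} => if L :|: S \subset T then f1 T else f2 T) => I ID SI.
  have [LI|LI] := boolP (L :|: S \subset I).
    have [S' [sLS' S'I smS' If1 cf1]] := f1P I ID LI.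
    by exists S'; rewrite sLS'; split=> //; apply: subset_trans sLS'; apply: subsetUr.
  have [|S' [SS' S'I smS' If2 cf2]] := f2P I _ SI; first by rewrite inE ID.
  exists S'; rewrite ifN; last by apply: contra LI => /subset_trans; apply.
  split=> //; case: cf2 => S'' [D'' [sD'' dD'' st eqX]].
  by exists S'', D''; split=> //; apply: subset_trans sD'.
have [/existsP[y /andP[ySD yd]]|] :=
    boolP [exists y, (y |: S \in D) && (survival t1 D (y |: S) < b1 * survival t1 D S)].
  have yS : y \notin S.
    apply: contraTN yd => yS; rewrite (setUidPr _) ?sub1set // -leNgt.
    by rewrite ler_piMl ?(andP b1_01).2 // survival_ge0.
  apply: (branch [set y] i.+1 j) => //.
  - by rewrite sub1set.
  - by rewrite cardsU1 yS addSn.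
  - by rewrite exprS; apply: le_trans (ltW yd) _; rewrite ler_wpM2l ?(andP b1_01).1.
  - by apply: le_trans s2; apply: survival_antitone.
rewrite negb_exists => /forallP ok1.
have [/existsP[L /andP[LSD Ld]]|] := boolP [exists L : {set V}, (L :|: S \in D) &&
    (survival t2 D (L :|: S) < b2 ^+ #|L :\: S| * survival t2 D S)].
  (* All new vertices of [L] enter at once, each paid for by one factor [b2]. *)
  apply: (branch L i (j + #|L :\: S|)%N) => //.
  - apply: contraTN Ld => LS.
    have /eqP -> : L :\: S == set0 by rewrite setD_eq0.
    by rewrite cards0 expr0 mul1r (setUidPr LS) ltxx.
  - rewrite -(cardsID S) (setIC (_ :|: _)) (setIidPl (subsetUr L S)) setDUl setDv setU0 addnA leq_add2r //.
  - by apply: le_trans s1; apply: survival_antitone.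
  - by rewrite addnC exprD; apply: le_trans (ltW Ld) _; rewrite ler_wpM2l ?exprn_ge0.
rewrite negb_exists => /forallP ok2.
exists (fun=> [set y | y |: S \in D]) => I ID SI; exists S; split=> //.
- exists i, j; split=> //.
    exact: le_trans (survival_ge t1_01 SD) s1.
  exact: le_trans (survival_ge t2_01 SD) s2.
- by apply/subsetP=> y yI; rewrite inE; apply: dD ID _; rewrite subUset sub1set yI.
- exists S, D; split=> //; split=> //.
    by move=> y ySD; move: (ok1 y); rewrite ySD /= -leNgt.
  by move=> L LSD; move: (ok2 L); rewrite LSD /= -leNgt.
Qed.

End Containers.

(** * Operations on measures and their effect on [Lambda] *)

Section Measures.
Variables (R : realType) (T : finType).
Implicit Types (p c : R) (G K : {set {set T}}) (nu mu : {set T} -> R) (A E L : {set T}).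

Definition restrict G nu : {set T} -> R := fun E => if E \in G then nu E else 0.

Lemma restrict_ge0 G nu : (forall E, 0 <= nu E) -> forall E, 0 <= restrict G nu E.
Proof. by move=> nu0 E; rewrite /restrict; case: ifP. Qed.

Lemma sum_restrict G K nu (P : pred {set T}) : G \subset K ->
  \sum_(E in K | P E) restrict G nu E = \sum_(E in G | P E) nu E.
Proof.
move=> sGK; rewrite (bigID [in G]) /= [X in _ + X]big1 ?addr0.
  apply: eq_big => [E|E /andP[_ EG]]; last by rewrite /restrict EG.
  by case: (boolP (E \in G)) => [/(subsetP sGK) -> /=|]; rewrite ?andbF ?andbT.
by move=> E /andP[_ /negbTE EG]; rewrite /restrict EG.
Qed.

Lemma e_nu_restrict G K nu : G \subset K -> e_nu K (restrict G nu) = e_nu G nu.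
Proof.
move=> sGK; have := sum_restrict nu xpredT sGK.
by rewrite !big_mkcondr.
Qed.

Lemma d_nu_restrict G K nu L : G \subset K -> d_nu K (restrict G nu) L = d_nu G nu L.
Proof. exact: sum_restrict. Qed.

Lemma Lambda_restrict p G K nu : G \subset K ->
  Lambda p K (restrict G nu) = Lambda p G nu.
Proof. by move=> sGK; apply: eq_bigr => L _; rewrite d_nu_restrict. Qed.

(** Extension by zero changes neither side of the inequality. This is why the bad sets form a
    down-set. *)
Lemma janson_sub p c G K : G \subset K -> janson p c G -> janson p c K.
Proof.
move=> sGK [->|[c0 [nu [nu0 lt_nu]]]]; [by left | right; split=> //].
exists (restrict G nu); split; first exact: restrict_ge0.
by rewrite Lambda_restrict ?e_nu_restrict.
Qed.

Lemma d_nu_ge0 G nu L : (forall E, 0 <= nu E) -> 0 <= d_nu G nu L.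
Proof. by move=> nu0; apply: sumr_ge0. Qed.

Lemma d_nu_le_e_nu G nu L : (forall E, 0 <= nu E) -> d_nu G nu L <= e_nu G nu.
Proof.
move=> nu0; rewrite /e_nu (bigID (fun E => L \subset E)) /= lerDl.
exact: sumr_ge0.
Qed.

Lemma d_nu_sub G K nu L : (forall E, 0 <= nu E) -> G \subset K ->
  d_nu G nu L <= d_nu K nu L.
Proof.
move=> nu0 sGK; rewrite -(d_nu_restrict _ _ sGK); apply: ler_sum => E _.
by rewrite /restrict; case: ifP.
Qed.

Lemma Lambda_ge0 p G nu : 0 < p -> 0 <= Lambda p G nu.
Proof.
move=> p0; apply: sumr_ge0 => L _.
by rewrite mulr_ge0 ?sqr_ge0 // invr_ge0 exprn_ge0 // ltW.
Qed.

Lemma Lambda_sub p G K nu : 0 < p -> (forall E, 0 <= nu E) -> G \subset K ->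
  Lambda p G nu <= Lambda p K nu.
Proof.
move=> p0 nu0 sGK; apply: ler_sum => L _.
rewrite ler_wpM2r ?invr_ge0 ?exprn_ge0 ?(ltW p0) //.
by rewrite lerXn2r ?nnegrE ?d_nu_ge0 ?d_nu_sub.
Qed.

Lemma e_nuZ G nu c : e_nu G (fun E => c * nu E) = c * e_nu G nu.
Proof. by rewrite /e_nu mulr_sumr. Qed.

Lemma d_nuZ G nu c L : d_nu G (fun E => c * nu E) L = c * d_nu G nu L.
Proof. by rewrite /d_nu mulr_sumr. Qed.

Lemma LambdaZ p G nu c : Lambda p G (fun E => c * nu E) = c ^+ 2 * Lambda p G nu.
Proof.
by rewrite /Lambda mulr_sumr; apply: eq_bigr => L _; rewrite d_nuZ exprMn mulrA.
Qed.

Lemma janson_normalized p c G : 0 < p -> 0 < c -> janson p c G ->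
  exists nu, [/\ forall E, 0 <= nu E, e_nu G nu = 1 & Lambda p G nu < c^-1].
Proof.
move=> p0 c0 [c_eq|[_ [nu [nu0 lt_nu]]]]; first by rewrite c_eq ltxx in c0.
have e0 : 0 <= e_nu G nu by apply: sumr_ge0.
have en0 : e_nu G nu != 0.
  apply: contraTneq lt_nu => ->; rewrite expr0n mul0r -leNgt.
  exact: Lambda_ge0.
exists (fun E => (e_nu G nu)^-1 * nu E); split.
- by move=> E; rewrite mulr_ge0 ?invr_ge0.
- by rewrite e_nuZ mulVf.
- by rewrite LambdaZ exprVn mulrC ltr_pdivrMr ?exprn_gt0 ?lt0r ?en0 // mulrC.
Qed.

Lemma d_nuD G nu mu L :
  d_nu G (fun E => nu E + mu E) L = d_nu G nu L + d_nu G mu L.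
Proof. exact: big_split. Qed.

Lemma e_nuD G nu mu : e_nu G (fun E => nu E + mu E) = e_nu G nu + e_nu G mu.
Proof. exact: big_split. Qed.

Lemma sum_d_nu (P : pred {set T}) G nu (f : {set T} -> R) :
  \sum_(L : {set T} | P L) d_nu G nu L * f L =
  \sum_(E in G) nu E * \sum_(L : {set T} | P L && (L \subset E)) f L.
Proof.
transitivity (\sum_(L : {set T} | P L) \sum_(E in G | L \subset E) nu E * f L).
  by apply: eq_bigr => L _; rewrite mulr_suml.
rewrite (exchange_big_dep [in G]) /=; last by move=> L E _ /andP[].
apply: eq_bigr => E EG; rewrite mulr_sumr; apply: eq_bigl => L.
by rewrite EG.
Qed.

Lemma sum_d_nu1 (k : nat) G nu : uniform k G ->
  \sum_u d_nu G nu [set u] = k%:R * e_nu G nu.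
Proof.
move=> uG; rewrite /d_nu (exchange_big_dep [in G]) /=; last by move=> L E _ /andP[].
rewrite /e_nu mulr_sumr; apply: eq_bigr => E EG.
rewrite (eq_bigl [in E]); last by move=> u; rewrite EG sub1set.
by rewrite sumr_const uG // mulr_natl.
Qed.

(** The form as a sum over pairs of edges, which makes [Lambda] comparable with the codegree sums of
    the second moment. *)
Lemma LambdaE p G nu : Lambda p G nu =
  \sum_(E in G) \sum_(E' in G) nu E * nu E' *
    \sum_(L : {set T} | (2 <= #|L|)%N && (L \subset E :&: E')) p ^- #|L|.
Proof.
rewrite /Lambda (eq_bigr (fun L => d_nu G nu L * (d_nu G nu L * p ^- #|L|))); last first.
  by move=> L _; rewrite expr2 mulrA.
rewrite sum_d_nu; apply: eq_bigr => E _.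
rewrite sum_d_nu mulr_sumr; apply: eq_bigr => E' _.
rewrite -mulrA; congr (_ * (_ * _)); apply: eq_bigl => L.
by rewrite subsetI andbA.
Qed.

End Measures.

(** * A Janson measure with small vertex degrees *)

Section Spread.
Variables (R : realType) (T V : finType) (s r : nat) (p c : R).
Variables (H : {set {set V}}) (pi : V -> T).
Hypotheses (p_gt0 : 0 < p) (c_gt0 : 0 < c) (s_gt0 : (0 < s)%N) (r_gt0 : (0 < r)%N).
Hypotheses (unifH : uniform s H) (injH : forall E, E \in H -> #|pi @: E| = #|E|).
Hypothesis fiber2 : forall L : {set V}, (#|L| <= 2 * #|pi @: L|)%N.

Lemma hproj_sub (X Y : {set V}) : Y \subset X ->
  hproj pi (sub_hgraph H Y) \subset hproj pi (sub_hgraph H X).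
Proof.
move=> YX; apply: imsetS; apply/subsetP=> E; rewrite !inE => /andP[-> EY].
exact: subset_trans YX.
Qed.

Lemma uniform_hproj (X : {set V}) : uniform s (hproj pi (sub_hgraph H X)).
Proof.
move=> A /imsetP[E]; rewrite inE => /andP[EH _] ->.
by rewrite injH // unifH.
Qed.

(* Adding up measures one at a time, each supported away from the vertices that
   are already heavy; convexity keeps Lambda under control. *)
Lemma spread_partial (X : {set V}) :
  (forall Y : {set V}, Y \subset X ->
    #|X|%:R - #|V|%:R / (2 ^+ 8 * r%:R) <= #|Y|%:R :> R ->
    janson p c (hproj pi (sub_hgraph H Y))) ->
  forall k : nat, (k <= #|V|)%N ->
  exists nu : {set T} -> R, [/\ forall E, 0 <= nu E,
    e_nu (hproj pi (sub_hgraph H X)) nu = k%:R,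
    Lambda p (hproj pi (sub_hgraph H X)) nu <= k%:R ^+ 2 / c &
    forall u, d_nu (hproj pi (sub_hgraph H X)) nu [set u] <= 2 ^+ 9 * r%:R * s%:R + 1].
Proof.
set K := hproj pi (sub_hgraph H X) => jan; elim=> [|k IH] kn.
  exists (fun=> 0); split=> //.
  - by rewrite /e_nu big1.
  - by rewrite /Lambda big1 ?expr0n ?mul0r // => L _; rewrite /d_nu big1 // expr0n mul0r.
  - by move=> u; rewrite /d_nu big1 // addr_ge0 // mulr_ge0 // mulr_ge0.
have {IH}[nu [nu0 e_nu_k Lam_nu d_le]] := IH (ltnW kn).
have rR : 0 < r%:R :> R by rewrite ltr0n.
have sR : 0 < s%:R :> R by rewrite ltr0n.
(* The degrees add up to [s * k], at most [s * #|V|], so at most [#|V| / (2 ^+ 9 * r)] vertices are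
   heavy. Their preimage is at most twice as large, which is exactly what [Y] may lose. *)
pose heavy := [set u | 2 ^+ 9 * r%:R * s%:R < d_nu K nu [set u]].
have heavy_card : #|heavy|%:R * (2 ^+ 9 * r%:R) <= #|V|%:R :> R.
  rewrite -(ler_pM2r sR); apply: (@le_trans _ _ (\sum_u d_nu K nu [set u])).
    rewrite [leRHS](bigID [in heavy]) /= -[leLHS]addr0 lerD //; last first.
      by apply: sumr_ge0 => u _; apply: d_nu_ge0.
    rewrite -mulrA mulr_natl -sumr_const; apply: ler_sum => u.
    by rewrite inE => /ltW.
  rewrite (sum_d_nu1 _ (@uniform_hproj X)) e_nu_k mulrC ler_wpM2r ?(ltW sR) //.
  by rewrite ler_nat ltnW.
pose L := [set x in X | pi x \in heavy].
have L_card : #|L|%:R <= #|V|%:R / (2 ^+ 8 * r%:R) :> R.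
  rewrite ler_pdivlMr; last by rewrite mulr_gt0 // exprn_gt0.
  have : #|L|%:R <= 2 * #|heavy|%:R :> R.
    rewrite -natrM ler_nat (leq_trans (fiber2 L)) // leq_mul2l /=.
    by apply: subset_leq_card; apply/subsetP=> _ /imsetP[x /[!inE] /andP[_ hx] ->].
  move=> le2; apply: le_trans (le_trans _ heavy_card).
    exact: ler_wpM2r le2.
  rewrite le_eqVlt; apply/orP; left; apply/eqP; ring.
pose Y := X :\: L.
have sYX : Y \subset X by apply: subsetDl.
have [|mu [mu0 e_mu Lam_mu]] := janson_normalized p_gt0 c_gt0 (jan Y sYX _).
  have -> : #|X|%:R = #|Y|%:R + #|L|%:R :> R.
    rewrite -natrD -(cardsID L X) addnC; congr (_ + _)%:R; congr (#|pred_of_set _|).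
    by apply/setP=> x; rewrite !inE; case: (x \in X).
  by rewrite -addrA gerDl subr_le0.
set KY := hproj pi (sub_hgraph H Y) in e_mu Lam_mu.
have sK : KY \subset K by apply: hproj_sub.
exists (fun E => nu E + restrict KY mu E); split.
- by move=> E; rewrite addr_ge0 // restrict_ge0.
- by rewrite e_nuD e_nu_restrict // e_nu_k e_mu natr1.
(* Convexity with weights tuned to masses [k] and 1: the difference of the two sides is the sum of
   the squares [(a - k * b) ^+ 2], weighted by powers of [p]. *)
- have key : k%:R * Lambda p K (fun E => nu E + restrict KY mu E) <=
      k.+1%:R * Lambda p K nu + k%:R * k.+1%:R * Lambda p KY mu.
    rewrite -(Lambda_restrict p mu sK) /Lambda !mulr_sumr -big_split /=.
    apply: ler_sum => M _; rewrite d_nuD.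
    set a := d_nu K nu M; set b := d_nu K _ M; set w := p ^- _.
    have w0 : 0 <= w by rewrite invr_ge0 exprn_ge0 // ltW.
    rewrite -subr_ge0 -natr1 [X in 0 <= X](_ : _ = (a - k%:R * b) ^+ 2 * w); last by ring.
    by rewrite mulr_ge0 ?sqr_ge0.
  have [k0|k0] := posnP k.
    have eqd M : d_nu K (fun E => nu E + restrict KY mu E) M = d_nu KY mu M.
      rewrite d_nuD d_nu_restrict //.
      suff -> : d_nu K nu M = 0 by rewrite add0r.
      apply: le_anti; rewrite d_nu_ge0 // andbT.
      by apply: le_trans (d_nu_le_e_nu _ _ nu0) _; rewrite e_nu_k k0.
    rewrite /Lambda; under eq_bigr do rewrite eqd.
    by rewrite -/(Lambda p KY mu) k0 expr1n mul1r ltW.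
  have kR : 0 < k%:R :> R by rewrite ltr0n.
  rewrite -(ler_pM2l kR); apply: le_trans key _.
  apply: (@le_trans _ _ (k.+1%:R * (k%:R ^+ 2 / c) + k%:R * k.+1%:R * c^-1)).
    by rewrite lerD // ler_wpM2l // ?mulr_ge0 // ltW.
  by rewrite -natr1 le_eqVlt; apply/orP; left; apply/eqP; ring.
- move=> u; rewrite d_nuD d_nu_restrict //.
  (* A heavy vertex gains nothing, since [Y] avoids its preimage; a light one gains at most the
     total mass 1 of [mu]. *)
  have [uh|uh] := boolP (u \in heavy).
    suff -> : d_nu KY mu [set u] = 0 by rewrite addr0.
    apply: big1 => A /andP[/imsetP[E]]; rewrite inE => /andP[_ EY] ->.
    rewrite sub1set => /imsetP[x xE ux].
    have /subsetP/(_ x xE) := EY; rewrite in_setD => /andP[/negP xL xX].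
    by case: xL; rewrite inE xX -ux uh.
  rewrite lerD //; first by rewrite inE -leNgt in uh.
  by rewrite -e_mu d_nu_le_e_nu.
Qed.

(** The sum of [#|V|] unit measures is divided by [#|V|]; the summand 1 in the degree bound is
    absorbed by doubling [2 ^+ 9]. *)
Lemma spread_measure (X : {set V}) : (0 < #|V|)%N ->
  (forall Y : {set V}, Y \subset X ->
    #|X|%:R - #|V|%:R / (2 ^+ 8 * r%:R) <= #|Y|%:R :> R ->
    janson p c (hproj pi (sub_hgraph H Y))) ->
  exists nu : {set T} -> R, [/\ forall E, 0 <= nu E,
    e_nu (hproj pi (sub_hgraph H X)) nu = 1,
    Lambda p (hproj pi (sub_hgraph H X)) nu <= c^-1 &
    forall u, d_nu (hproj pi (sub_hgraph H X)) nu [set u] <=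
      2 ^+ 10 * r%:R * s%:R / #|V|%:R].
Proof.
move=> V0 /spread_partial/(_ _ (leqnn _))[nu [nu0 e_nu_n Lam_nu d_le]].
have nR : 0 < #|V|%:R :> R by rewrite ltr0n.
exists (fun E => #|V|%:R^-1 * nu E); split.
- by move=> E; rewrite mulr_ge0 ?invr_ge0.
- by rewrite e_nuZ e_nu_n mulVf // lt0r_neq0.
- rewrite LambdaZ exprVn mulrC ler_pdivrMr ?exprn_gt0 //.
  by rewrite mulrC.
- move=> u; rewrite d_nuZ mulrC ler_wpM2r ?invr_ge0 //.
  apply: le_trans (d_le u) _.
  have : 1 <= r%:R * s%:R :> R by rewrite -natrM ler1n muln_gt0 r_gt0.
  by rewrite -!mulrA; move: (_ * _ : R) => z; lra.
Qed.

End Spread.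

(** * Edges excluded by the fingerprint carry little mass *)

Section ExcludedEdges.
Variables (R : realFieldType) (V : finType) (t : R) (s : nat).
Variables (D G : {set {set V}}) (S : {set V}) (a : {set V} -> R).
Hypotheses (t_01 : 0 < t < 1) (s_gt0 : (0 < s)%N) (dD : downset D) (SD : S \in D).
Hypotheses (a_ge0 : forall E, 0 <= a E) (unifG : uniform s G).
Hypothesis excluded : forall E, E \in G -> E :|: S \notin D.
Hypothesis robust : forall E y, E \in G -> y \in E ->
  (1 - (16 * s%:R ^+ 2)^-1) * survival t D S <= survival t D (y |: S).

(** The exponent is one below the size of the intersection because prefixes at a common vertex [y]
    omit [y]. Pairs meeting in one vertex get 0, being covered by [deg y ^+ 2]. *)
Let overlap (E E' : {set V}) : R :=
  (2 <= #|E :&: E'|)%N%:R * t ^- #|E :&: E'|.-1.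

Let deg y : R := \sum_(E in G | y \in E) a E.
Let codeg y : R :=
  \sum_(E in G | y \in E) \sum_(E' in G | y \in E') a E * a E' * overlap E E'.
Let pushed y (A : {set V}) : R := \sum_(E in G | y \in E)
  a E * ((prefix_set E y \subset A)%:R * t ^- #|prefix_set E y :\: S|).

Let t_gt0 : 0 < t. Proof. by case/andP: t_01. Qed.
Let t_le1 : t <= 1. Proof. by case/andP: t_01 => _ /ltW. Qed.
Let t01 : 0 <= t <= 1. Proof. by rewrite ltW // t_le1. Qed.

Let Vpos (y : V) : 0 < #|V|%:R :> R.
Proof. by rewrite ltr0n; apply/card_gt0P; exists y. Qed.

Lemma overlap_ge0 (E E' : {set V}) : 0 <= overlap E E'.
Proof. by rewrite mulr_ge0 // invr_ge0 exprn_ge0 // ltW. Qed.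

Lemma codeg_ge0 y : 0 <= codeg y.
Proof.
by apply: sumr_ge0 => E _; apply: sumr_ge0 => E' _; apply: mulr_ge0;
  rewrite ?overlap_ge0 ?mulr_ge0.
Qed.

(** For an excluded edge the survival at [E :|: S] is 0, so the drop along [E] is the whole survival
    of [S]; the drops are then regrouped by vertex. *)
Lemma excluded_mass_pushed : (\sum_(E in G) a E) * survival t D S =
  \sum_y \sum_(A in D | (S \subset A) && (y |: A \notin D))
    samp_weight t S A * pushed y A.
Proof.
rewrite mulr_suml (eq_bigr (fun E : {set V} => \sum_(y in E)
    \sum_(A in D | (S \subset A) && (y |: A \notin D)) samp_weight t S A *
      (a E * ((prefix_set E y \subset A)%:R * t ^- #|prefix_set E y :\: S|)))).
  rewrite (exchange_big_dep xpredT) //=; apply: eq_bigr => y _.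
  rewrite exchange_big /=; apply: eq_bigr => A _.
  by rewrite mulr_sumr.
move=> E EG; have := survival_drop_edge S E t_gt0 dD.
rewrite (survival_notin t dD (excluded EG)) subr0 => ->; rewrite mulr_sumr;
  apply: eq_bigr => y _.
by rewrite mulr_sumr; apply: eq_bigr => A _; rewrite mulrCA.
Qed.

Lemma pushed_second_moment y :
  \sum_(A in D | S \subset A) samp_weight t S A * pushed y A ^+ 2 <=
  survival t D S * (deg y ^+ 2 + codeg y).
Proof.
pose Gy := [set E in G | y \in E].
have eqGy E : (E \in Gy) = (E \in G) && (y \in E) by rewrite inE.
have t01' : 0 < t <= 1 by rewrite t_gt0.
have := survival_second_moment S Gy (fun E => prefix_set E y) t01' dD a_ge0.
rewrite (eq_bigr (fun A => samp_weight t S A * pushed y A ^+ 2)); last first.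
  by move=> A _; rewrite /pushed (eq_bigl _ _ eqGy).
move/le_trans; apply; rewrite ler_wpM2l ?survival_ge0 //.
rewrite expr2 /deg /codeg mulr_suml -big_split (eq_bigl _ _ eqGy) /=.
apply: ler_sum => E /andP[EG yE].
rewrite mulr_sumr -big_split (eq_bigl _ _ eqGy) /=.
apply: ler_sum => E' /andP[EG' yE'].
rewrite -{2}[a E * a E']mulr1 -mulrDr ler_wpM2l ?mulr_ge0 //.
have cpre : (#|prefix_set E y :&: prefix_set E' y| <= #|E :&: E'|.-1)%N.
  rewrite [in leqRHS](cardsD1 y) !inE yE yE' /=; apply: subset_leq_card.
  by rewrite setDIl setISS ?prefix_setD1.
apply: (@le_trans _ _ (t ^- #|E :&: E'|.-1)).
  by rewrite lef_pV2 ?posrE ?exprn_gt0 // ler_wiXn2l // ltW.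
rewrite /overlap; case: (boolP (2 <= #|E :&: E'|)%N) => [_|];
  first by rewrite mul1r lerDr.
by rewrite -ltnNge mul0r addr0; case: #|_| => [|[|k]] //= _; rewrite expr0 invr1.
Qed.

(* Weighted AM-GM in place of Cauchy-Schwarz: the weight 4 s (deg y + 1/n) is
   tuned so that both resulting terms are linear in deg y, up to the codegree. *)
Lemma pushed_mass_le y :
  \sum_(A in D | (S \subset A) && (y |: A \notin D)) samp_weight t S A * pushed y A <=
  survival t D S * ((8 * s%:R)^-1 *
    (2 * deg y + #|V|%:R^-1 + #|V|%:R * codeg y)).
Proof.
have nR := Vpos y; have sR : 0 < s%:R :> R by rewrite ltr0n.
have d0 : 0 <= deg y by apply: sumr_ge0.
have c0 := codeg_ge0 y.
have ninv0 : 0 < #|V|%:R^-1 :> R by rewrite invr_gt0.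
have Z0 : 0 <= survival t D S by apply: survival_ge0.
have rhs0 : 0 <= (8 * s%:R)^-1 * (2 * deg y + #|V|%:R^-1 + #|V|%:R * codeg y).
  apply: mulr_ge0; first by rewrite invr_ge0 mulr_ge0 // ltW.
  by rewrite addr_ge0 ?mulr_ge0 ?(ltW nR) // addr_ge0 ?mulr_ge0 // ltW.
have [/existsP[E /andP[EG yE]]|] := boolP [exists E, (E \in G) && (y \in E)]; last first.
  rewrite negb_exists => /forallP noE; rewrite big1; first exact: mulr_ge0.
  move=> A _.
  by rewrite /pushed big1 ?mulr0 // => E HE; move: (noE E); rewrite HE.
pose th := 4 * s%:R * (deg y + #|V|%:R^-1).
have th0 : 0 < th by rewrite !mulr_gt0 // ltr_wpDl.
have ith0 : 0 <= (2 * th)^-1 by rewrite invr_ge0 ltW // mulr_gt0.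
have th20 : 0 <= th / 2 by rewrite divr_ge0 // ltW.
have amgm (f : R) : f <= th / 2 + f ^+ 2 / (2 * th).
  rewrite -subr_ge0 (_ : _ - _ = (f - th) ^+ 2 / (2 * th)).
    by rewrite mulr_ge0 ?sqr_ge0 // invr_ge0 mulr_ge0 // ltW.
  by field; rewrite lt0r_neq0.
apply: (@le_trans _ _ (th / 2 * (survival t D S - survival t D (y |: S)) +
  (2 * th)^-1 * \sum_(A in D | S \subset A) samp_weight t S A * pushed y A ^+ 2)).
  rewrite survival_drop // mulr_sumr.
  apply: (@le_trans _ _ (\sum_(A in D | (S \subset A) && (y |: A \notin D))
      (th / 2 * samp_weight t S A + (2 * th)^-1 * (samp_weight t S A * pushed y A ^+ 2)))).
    apply: ler_sum => A _;
      apply: le_trans (ler_wpM2l (samp_weight_ge0 S A t01) (amgm _)) _.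
    by rewrite le_eqVlt; apply/orP; left; apply/eqP; ring.
  rewrite big_split /= lerD2l -mulr_sumr ler_wpM2l //.
  rewrite [leRHS](bigID (fun A => y |: A \notin D)) /=.
  rewrite (eq_bigl (fun A => (A \in D) && (S \subset A) && (y |: A \notin D))).
    by rewrite lerDl; apply: sumr_ge0 => A _; rewrite mulr_ge0 ?sqr_ge0 ?samp_weight_ge0.
  by move=> A; rewrite andbA.
(* Stability at single vertices enters here. It bounds the probability of the sets that [y] pushes
   out, the factor of [th / 2] in the linear term. *)
have drop_le : survival t D S - survival t D (y |: S) <=
    (16 * s%:R ^+ 2)^-1 * survival t D S.
  by have := robust EG yE; rewrite mulrBl mul1r; move: (_ * _) => z; lra.
apply: (@le_trans _ _ (th / 2 * ((16 * s%:R ^+ 2)^-1 * survival t D S) +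
   (2 * th)^-1 * (survival t D S * (deg y ^+ 2 + codeg y)))).
  by rewrite lerD // ler_wpM2l // pushed_second_moment.
have -> : th / 2 * ((16 * s%:R ^+ 2)^-1 * survival t D S) =
    survival t D S * ((8 * s%:R)^-1 * (deg y + #|V|%:R^-1)).
  by rewrite /th; field; rewrite !lt0r_neq0.
rewrite [X in _ + X]mulrCA -mulrDr ler_wpM2l //.
rewrite (_ : 2 * deg y + _ + _ = (deg y + #|V|%:R^-1) + (deg y + #|V|%:R * codeg y));
  last by ring.
rewrite [leRHS]mulrDr lerD2l /th.
rewrite (_ : (2 * _)^-1 = (8 * s%:R)^-1 * (deg y + #|V|%:R^-1)^-1); last first.
  by rewrite -invfM; congr (_^-1); ring.
rewrite -mulrA ler_wpM2l ?invr_ge0 ?mulr_ge0 ?(ltW sR) //.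
rewrite mulrC ler_pdivrMr ?ltr_wpDl // mulrDl !mulrDr.
rewrite (_ : #|V|%:R * codeg y * #|V|%:R^-1 = codeg y); last by field; rewrite lt0r_neq0.
have := mulr_ge0 d0 (ltW ninv0); have := mulr_ge0 (mulr_ge0 (ltW nR) c0) d0.
by rewrite expr2; lra.
Qed.

Lemma sum_codeg : \sum_y codeg y =
  \sum_(E in G) \sum_(E' in G) a E * a E' * (#|E :&: E'|%:R * overlap E E').
Proof.
rewrite /codeg (exchange_big_dep [in G]) /=; last by move=> y E _ /andP[].
apply: eq_bigr => E EG; rewrite (exchange_big_dep [in G]) /=;
  last by move=> y E' _ /andP[].
apply: eq_bigr => E' EG'.
rewrite (eq_bigl [in E :&: E']); last by move=> y; rewrite !inE EG EG'.
by rewrite sumr_const -[LHS]mulr_natl mulrCA.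
Qed.

(** Summed over all vertices, with [e] the mass of [G], the bounds give
    [8 * s * e <= 2 * s * e + 1 + 1 / 2], the degrees adding up to [s * e]. Hence [e] is at most
    [1 / (4 * s)]. *)
Lemma excluded_mass_le :
  #|V|%:R * (\sum_(E in G) \sum_(E' in G)
     a E * a E' * (#|E :&: E'|%:R * ((2 <= #|E :&: E'|)%N%:R * t ^- #|E :&: E'|.-1)))
    <= 1 / 2 ->
  \sum_(E in G) a E <= 1 / 4.
Proof.
move=> ov.
have [V0|[E EG]] := set_0Vmem G; first by rewrite V0 big_set0; lra.
have /card_gt0P[y0 _] : (0 < #|E|)%N by rewrite unifG.
have nR := Vpos y0.
have sR : 1 <= s%:R :> R by rewrite ler1n.
have Z0 : 0 < survival t D S.
  apply: lt_le_trans (survival_ge t01 SD).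
  by rewrite exprn_gt0 // subr_gt0; case/andP: t_01.
have := excluded_mass_pushed.
move/eqP; rewrite eq_le => /andP[+ _].
move/le_trans/(_ (ler_sum _ (fun y _ => pushed_mass_le y))).
rewrite -mulr_sumr mulrC ler_pM2l // -mulr_sumr !big_split /= -!mulr_sumr sum_codeg.
have -> : \sum_(y : V) #|V|%:R^-1 = 1 :> R.
  by rewrite sumr_const -[LHS]mulr_natr mulVf // lt0r_neq0.
have -> : \sum_y deg y = s%:R * \sum_(E in G) a E.
  rewrite /deg (exchange_big_dep [in G]) /=; last by move=> y E' _ /andP[].
  rewrite mulr_sumr; apply: eq_bigr => E' EG'.
  rewrite (eq_bigl [in E']); last by move=> y; rewrite EG'.
  by rewrite sumr_const unifG // mulr_natl.
move: (\sum_(E in G) a E) => e; rewrite mulrC ler_pdivlMr ?mulr_gt0 ?ltr0n //.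
move: (_ * \sum_(i in G) _) ov => o o_le He.
have : e * (6 * s%:R) <= 3 / 2 by lra.
have [|e0] := leP e 0; first by lra.
have := ler_wpM2l (ltW e0) sR; lra.
Qed.

End ExcludedEdges.

(** * Overlap sums are controlled by [Lambda] of the projection *)

Section Overlaps.
Variables (R : realType) (V T : finType) (pi : V -> T) (G : {set {set V}}).
Variables (nu : {set T} -> R) (p t : R).
Hypotheses (p_gt0 : 0 < p) (p_small : 2 * p <= t) (nu_ge0 : forall E, 0 <= nu E).
Hypothesis injG : forall E, E \in G -> #|pi @: E| = #|E|.
Hypothesis inj_proj : {in G &, injective (fun E : {set V} => pi @: E)}.

Lemma overlap_weight_le (k : nat) : (2 <= k)%N ->
  k%:R * t ^- k.-1 <= 2 * p ^+ 2 / t * p ^- k.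
Proof.
case: k => [|[|j]] //= _; have t0 : 0 < t by apply: lt_le_trans p_small; rewrite mulr_gt0.
have pj : p ^+ j != 0 by rewrite lt0r_neq0 // exprn_gt0.
have tj : t ^+ j != 0 by rewrite lt0r_neq0 // exprn_gt0.
rewrite (_ : 2 * p ^+ 2 / t * p ^- j.+2 = 2 * p ^- j / t); last first.
  by rewrite !exprS; field; rewrite pj !lt0r_neq0.
rewrite exprS invfM mulrA [leLHS]mulrAC ler_pM2r ?invr_gt0 //.
rewrite ler_pdivlMr ?exprn_gt0 // mulrAC ler_pdivrMr ?exprn_gt0 //.
(* With [k = j + 2], the factor [k] is at most [2 * 2 ^ j], and each factor 2 turns a [p] into
   [2 * p <= t]. *)
apply: (@le_trans _ _ (2 * (2 * p) ^+ j)).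
  rewrite exprMn mulrA ler_wpM2r ?exprn_ge0 ?(ltW p_gt0) // -exprS -natrX ler_nat.
  by rewrite expnS; elim: j {pj tj} => // j IH; rewrite expnS; lia.
by rewrite ler_pM2l // lerXn2r ?nnegrE ?mulr_ge0 ?(ltW t0) ?(ltW p_gt0).
Qed.

(** Among the sets [L] in the expansion of [Lambda], the single set [pi @: (E :&: E')] suffices; it
    has the size of [E :&: E'] because [pi] is injective on [E]. *)
Lemma overlap_le_Lambda :
  \sum_(E in G) \sum_(E' in G) nu (pi @: E) * nu (pi @: E') *
    (#|E :&: E'|%:R * ((2 <= #|E :&: E'|)%N%:R * t ^- #|E :&: E'|.-1)) <=
  2 * p ^+ 2 / t * Lambda p (hproj pi G) nu.
Proof.
have t0 : 0 < t by apply: lt_le_trans p_small; rewrite mulr_gt0.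
have c0 : 0 <= 2 * p ^+ 2 / t by rewrite divr_ge0 ?mulr_ge0 ?sqr_ge0 // ltW.
rewrite LambdaE /hproj big_imset //= mulr_sumr; apply: ler_sum => E EG.
rewrite big_imset //= mulr_sumr; apply: ler_sum => E' EG'.
rewrite [leRHS]mulrCA ler_wpM2l ?mulr_ge0 //.
have pV0 (L : {set T}) : 0 <= p ^- #|L| by rewrite invr_ge0 exprn_ge0 // ltW.
have [k2|k2] := boolP (2 <= #|E :&: E'|)%N; last first.
  by rewrite mul0r mulr0 mulr_ge0 // sumr_ge0.
rewrite mul1r; apply: le_trans (overlap_weight_le k2) _; rewrite ler_wpM2l //.
have injE : {in E &, injective pi} by apply/imset_injP; rewrite injG.
have cI : #|pi @: (E :&: E')| = #|E :&: E'|.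
  by apply: card_in_imset => x y /setIP[xE _] /setIP[yE _]; apply: injE.
rewrite (bigD1 (pi @: (E :&: E'))) /=; last first.
  by rewrite cI k2 subsetI !imsetS ?subsetIl ?subsetIr.
by rewrite cI lerDl sumr_ge0.
Qed.

End Overlaps.

(** * Adding the vertex [v] to edges and merging with [F] *)

Section AddVertex.
Variables (R : realType) (T : finType) (p : R) (v : T).
Implicit Types (F K W : {set {set T}}) (nu mu : {set T} -> R) (A L : {set T}).
Hypothesis p_gt0 : 0 < p.

Let pV_ge0 L : 0 <= p ^- #|L|. Proof. by rewrite invr_ge0 exprn_ge0 // ltW. Qed.

(* The contribution of A to the mixed term of Lambda p for the measure nu on F. *)
Definition cross_weight F nu A : R :=
  \sum_(L : {set T} | (2 <= #|L|)%N && (L \subset A)) d_nu F nu L * p ^- #|L|.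

Definition light_edges c F nu K := [set A in K | cross_weight F nu A <= c].

(** Weighted AM-GM bounds the [nu]-average of the cross weights by [2 / c + 1 / (8 * c')], at most
    [1 / (4 * c')]. By Markov's inequality, edges above twice that value have mass at most 1/2. *)
Lemma light_edges_mass (c c' : R) F K nu mu : 0 < c' -> 16 * c' <= c ->
  (forall E, 0 <= nu E) -> (forall E, 0 <= mu E) ->
  Lambda p F mu < c'^-1 -> Lambda p K nu <= c^-1 ->
  e_nu K nu <= e_nu (light_edges (2 * c')^-1 F mu K) nu + 1 / 2.
Proof.
move=> c'0 c'c nu0 mu0 LF LK.
have c0 : 0 < c by apply: lt_le_trans c'c; rewrite mulr_gt0.
set Kg := light_edges _ _ _ _.
have cross : \sum_(A in K) nu A * cross_weight F mu A <= (4 * c')^-1.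
  rewrite -sum_d_nu.
  apply: (@le_trans _ _ (2 * Lambda p K nu + 8^-1 * Lambda p F mu)).
    rewrite /Lambda !mulr_sumr -big_split /=; apply: ler_sum => L _.
    rewrite -subr_ge0 [X in 0 <= X](_ : _ =
      2 * (d_nu K nu L - 4^-1 * d_nu F mu L) ^+ 2 * p ^- #|L|); last by field; rewrite lt0r_neq0 // exprn_gt0.
    by rewrite mulr_ge0 // mulr_ge0 ?sqr_ge0.
  have : c^-1 <= 16^-1 * c'^-1 by rewrite -invfM lef_pV2 ?posrE ?mulr_gt0.
  rewrite invfM; lra.
have eK : e_nu K nu = e_nu Kg nu + \sum_(A in K | cross_weight F mu A > (2 * c')^-1) nu A.
  rewrite /e_nu (bigID (fun A => cross_weight F mu A <= (2 * c')^-1)) /=.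
  congr (_ + _); first by apply: eq_bigl => A; rewrite inE.
  by apply: eq_bigl => A; rewrite ltNge.
rewrite eK lerD2l.
have c'20 : 0 < (2 * c')^-1 by rewrite invr_gt0 mulr_gt0.
rewrite -(ler_pM2r c'20) (_ : 1 / 2 * (2 * c')^-1 = (4 * c')^-1); last first.
  by field; rewrite lt0r_neq0.
apply: le_trans cross;
  rewrite mulr_suml [leRHS](bigID (fun A => (2 * c')^-1 < cross_weight F mu A)) /=.
rewrite -[leLHS]addr0 lerD //.
  by apply: ler_sum => A /andP[_ /ltW ?]; rewrite ler_wpM2l.
apply: sumr_ge0 => A _; rewrite mulr_ge0 // sumr_ge0 // => L _.
by rewrite mulr_ge0 ?d_nu_ge0.
Qed.

Definition cone K := [set v |: A | A : {set T} in K].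

Lemma setU1_inj_in K : (forall A, A \in K -> v \notin A) ->
  {in K &, injective (fun A => v |: A)}.
Proof.
by move=> Kv A B AK BK eqAB; rewrite -(setU1K (Kv _ AK)) -(setU1K (Kv _ BK)) eqAB.
Qed.

Lemma e_nu_cone K nu : (forall A, A \in K -> v \notin A) ->
  e_nu (cone K) (fun B => nu (B :\ v)) = e_nu K nu.
Proof.
move=> Kv; rewrite /e_nu /cone big_imset; last exact: setU1_inj_in.
by apply: eq_bigr => A AK; rewrite setU1K ?Kv.
Qed.

Lemma d_nu_cone K nu L : (forall A, A \in K -> v \notin A) ->
  d_nu (cone K) (fun B => nu (B :\ v)) L = d_nu K nu (L :\ v).
Proof.
move=> Kv; rewrite /d_nu /cone big_imset_cond; last exact: setU1_inj_in.
apply: eq_big => [A|A /andP[AK _]]; last by rewrite setU1K ?Kv.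
by rewrite subDset.
Qed.

Lemma sum_set1 (f : {set T} -> R) :
  \sum_(L : {set T} | #|L| == 1%N) f L = \sum_u f [set u].
Proof.
(* The default [v] is never returned on a set of size 1. *)
rewrite (reindex_onto (fun u => [set u]) (fun L => odflt v [pick x in L])) /=.
  apply: eq_bigl => u; rewrite cards1 eqxx /=.
  by case: pickP => [x /set1P ->|/(_ u)]; rewrite ?eqxx ?set11.
move=> L /cards1P[x ->]; case: pickP => [y /set1P -> //|/(_ x)].
by rewrite set11.
Qed.

(** Sets [L] without [v] give [Lambda]; sets [v |: M] give [p^-1] times [Lambda] when [M] has at
    least two elements, and the squared vertex degrees when [M] is a singleton. *)
Lemma Lambda_cone_le K nu : (forall E, 0 <= nu E) ->
  \sum_(L : {set T} | (2 <= #|L|)%N) d_nu K nu (L :\ v) ^+ 2 * p ^- #|L| <=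
  (1 + p^-1) * Lambda p K nu + p ^- 2 * \sum_u d_nu K nu [set u] ^+ 2.
Proof.
move=> nu0; set f := fun L => d_nu K nu L ^+ 2.
have f0 L : 0 <= f L by apply: sqr_ge0.
have p1 : 0 < p^-1 by rewrite invr_gt0.
rewrite (bigID (fun L => v \in L)) /= addrC mulrDl mul1r -addrA lerD //.
  rewrite /Lambda [leRHS](bigID (fun L => v \in L)) /= -[leLHS]add0r lerD //.
    by apply: sumr_ge0 => L _; rewrite mulr_ge0 ?sqr_ge0.
  by apply: ler_sum => L /andP[_ vL]; rewrite (setDidPl _) // disjoint_sym disjoints1.
rewrite (reindex_onto (fun L => v |: L) (fun L => L :\ v)) /=; last first.
  by move=> L /andP[_ vL]; rewrite setD1K.
rewrite (eq_bigl (fun L => (v \notin L) && (1 <= #|L|)%N)); last first.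
  move=> L; rewrite setU11 andbT; have [vL|vL] := boolP (v \in L).
    by apply/negbTE; rewrite negb_and orbC; apply/orP; left;
      apply: contraTneq vL => <-; rewrite !inE eqxx.
  by rewrite setU1K // eqxx cardsU1 vL andbT.
apply: (@le_trans _ _ (\sum_(L : {set T} | (1 <= #|L|)%N) p^-1 * (f L * p ^- #|L|))).
  rewrite [leRHS](bigID (fun L => v \in L)) /= -[leLHS]add0r lerD //.
    apply: sumr_ge0 => L _; apply: mulr_ge0; first exact: ltW.
    exact: mulr_ge0.
  rewrite le_eqVlt; apply/orP; left; apply/eqP; apply: eq_big => [L|L /andP[vL _]];
    first by rewrite andbC.
  by rewrite setU1K // cardsU1 vL add1n (exprS p) invfM mulrCA.
rewrite (bigID (fun L => #|L| == 1%N)) /= addrC lerD //.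
  rewrite /Lambda mulr_sumr le_eqVlt; apply/orP; left; apply/eqP; apply: eq_bigl => L.
  by case: #|L| => [|[|k]].
rewrite -(sum_set1 f) mulr_sumr le_eqVlt; apply/orP; left; apply/eqP;
  apply: eq_big => [L|L /andP[_ /eqP ->]].
  by case: #|L| => [|[|k]].
by rewrite expr1 mulrCA -invfM -expr2 mulrC.
Qed.

Lemma janson_cone (c : R) W K nu : 0 < c -> (forall A, A \in K -> v \notin A) ->
  cone K \subset W -> (forall E, 0 <= nu E) -> e_nu K nu = 1 ->
  \sum_(L : {set T} | (2 <= #|L|)%N) d_nu K nu (L :\ v) ^+ 2 * p ^- #|L| <= (4 * c)^-1 ->
  janson p c W.
Proof.
move=> c0 Kv KW nu0 e1 LM; right; split=> //.
exists (restrict (cone K) (fun B => nu (B :\ v))); split; first exact: restrict_ge0.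
rewrite Lambda_restrict // e_nu_restrict // e_nu_cone // e1 expr1n mul1r.
apply: (@le_lt_trans _ _ (4 * c)^-1).
  by move: LM; rewrite /Lambda; under eq_bigr do rewrite -d_nu_cone //.
by rewrite ltf_pV2 ?posrE ?mulr_gt0 // ltr_pMl // ltr1n.
Qed.

(* The cone receives mass 2 c / c'; the mixed term then costs half of what the
   squared total mass gains, and the quadratic term only part of the other half. *)
Lemma janson_cone_union (c c' : R) F W K nu mu : 0 < c -> 0 < c' ->
  (forall A, A \in F -> v \notin A) -> (forall A, A \in K -> v \notin A) ->
  F \subset W -> cone K \subset W ->
  (forall E, 0 <= nu E) -> (forall E, 0 <= mu E) ->
  e_nu K nu = 1 -> e_nu F mu = 1 -> Lambda p F mu < c'^-1 ->
  (forall A, A \in K -> cross_weight F mu A <= (2 * c')^-1) ->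
  \sum_(L : {set T} | (2 <= #|L|)%N) d_nu K nu (L :\ v) ^+ 2 * p ^- #|L| <= (4 * c)^-1 ->
  janson p (c' + c) W.
Proof.
move=> c0 c'0 Fv Kv FW KW nu0 mu0 eK eF LF cw LM; right.
split; first by rewrite addr_gt0.
pose ep := 2 * c / c'.
have ep0 : 0 <= ep by rewrite divr_ge0 ?mulr_ge0 // ltW.
pose ga := restrict (cone K) (fun B => nu (B :\ v)).
exists (fun E => restrict F mu E + ep * ga E); split.
  move=> E; apply: addr_ge0; first exact: restrict_ge0.
  by apply: mulr_ge0 => //; apply: restrict_ge0.
rewrite e_nuD e_nuZ !e_nu_restrict // e_nu_cone // eK eF mulr1.
have dE L : d_nu W (fun E => restrict F mu E + ep * ga E) L =
    d_nu F mu L + ep * d_nu K nu (L :\ v).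
  by rewrite d_nuD d_nuZ !d_nu_restrict // d_nu_cone.
(* No edge of [F] contains [v], so the mixed sum reduces to the sets [L] avoiding [v], where it is
   the [nu]-average of the cross weights. *)
have dF0 L : v \in L -> d_nu F mu L = 0.
  move=> vL; apply: big1 => A /andP[AF /subsetP/(_ v vL)].
  by rewrite (negbTE (Fv _ AF)).
have cross : \sum_(L : {set T} | (2 <= #|L|)%N)
    d_nu F mu L * d_nu K nu (L :\ v) * p ^- #|L| <= (2 * c')^-1.
  rewrite (eq_bigr (fun L => d_nu K nu L * (d_nu F mu L * p ^- #|L|))).
    rewrite sum_d_nu -[leRHS]mul1r -[X in _ <= X * _]eK /e_nu mulr_suml;
      apply: ler_sum => A AK.
    by rewrite ler_wpM2l //; apply: cw.
  move=> L _; have [vL|vL] := boolP (v \in L); first by rewrite dF0 // !mul0r mulr0.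
  by rewrite (setDidPl _) ?mulrA 1?[X in X * _]mulrC // disjoint_sym disjoints1.
have -> : Lambda p W (fun E => restrict F mu E + ep * ga E) =
    Lambda p F mu + 2 * ep * (\sum_(L : {set T} | (2 <= #|L|)%N)
    d_nu F mu L * d_nu K nu (L :\ v) * p ^- #|L|) +
    ep ^+ 2 * (\sum_(L : {set T} | (2 <= #|L|)%N) d_nu K nu (L :\ v) ^+ 2 * p ^- #|L|).
  rewrite /Lambda !mulr_sumr -!big_split /=; apply: eq_bigr => L _.
  by rewrite dE; ring.
apply: (@lt_le_trans _ _ (c'^-1 + 2 * ep * (2 * c')^-1 + ep ^+ 2 * (4 * c)^-1)).
  rewrite ltr_leD ?ler_wpM2l ?sqr_ge0 //.
  by rewrite ltr_leD // ler_wpM2l // mulr_ge0.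
rewrite -subr_ge0 [X in 0 <= X](_ : _ = c ^+ 2 / (c' ^+ 2 * (c' + c))).
  by rewrite divr_ge0 ?sqr_ge0 // mulr_ge0 ?sqr_ge0 // ltW // addr_gt0.
by rewrite /ep; field; rewrite !lt0r_neq0 // addr_gt0.
Qed.

End AddVertex.

(** * Bounding the number of fingerprints *)

Section Counting.
Variables (R : realType) (V : finType).
Implicit Types (x y b q : R).

Lemma expRN2_le x : 0 <= x <= 1 / 2 -> expR (- (2 * x)) <= 1 - x.
Proof.
case/andP=> x0 x12; rewrite expRN.
have h : 1 + 2 * x <= expR (2 * x) by apply: expR_ge1Dx.
apply: (@le_trans _ _ (1 + 2 * x)^-1).
  by rewrite lef_pV2 ?posrE ?expR_gt0 //; lra.
by rewrite -div1r ler_pdivrMr; [nra | lra].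
Qed.

(** Logarithms of both sides are compared, with [expRN2_le] bounding the left side from below. *)
Lemma exponent_le x b y (i : nat) : 0 <= x <= 1 / 2 -> 0 <= b -> b <= expR (- y) ->
  (1 - x) ^+ #|V| <= b ^+ i -> y * i%:R <= 2 * x * #|V|%:R.
Proof.
move=> x01 b0 by_ le_xb.
have : expR (- (2 * x)) ^+ #|V| <= expR (- y) ^+ i.
  apply: (@le_trans _ _ ((1 - x) ^+ #|V|)).
    rewrite lerXn2r ?nnegrE ?expR_ge0 ?expRN2_le //; lra.
  by apply: le_trans le_xb _; rewrite lerXn2r ?nnegrE ?expR_ge0.
by rewrite -!expRM_natr ler_expR; lra.
Qed.

(** Generating function: the sum of [q ^+ #|S|] over all [S] is [(1 + q) ^+ #|V|], and each counted
    set contributes at least [q] to the power [m]. With [m = 4 * q * #|V|], the total is at most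
    [expR (1 / 4)] to the power [m], hence at most [2] to the power [m]. *)
Lemma count_small_sets q : 0 < q < 1 / 8 ->
  #|[set S : {set V} | #|S|%:R <= 4 * q * #|V|%:R]|%:R <=
  (2 / q) `^ (4 * q * #|V|%:R).
Proof.
case/andP=> q0 q8; set m := 4 * q * #|V|%:R.
have m0 : 0 <= m by rewrite !mulr_ge0 // ltW.
have qm0 : 0 < q `^ m by apply: powR_gt0.
rewrite powRM ?invr_ge0 ?(ltW q0) // -powR_inv1 ?(ltW q0) // -powRrM mulN1r powRN.
rewrite ler_pdivlMr //.
apply: (@le_trans _ _ (\sum_(S : {set V}) q ^+ #|S| * 1 ^+ #|~: S|)).
  rewrite [leRHS](bigID [in [set S : {set V} | #|S|%:R <= m]]) /= -[leLHS]addr0.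
  apply: lerD; last by apply: sumr_ge0 => S _; rewrite expr1n mulr1 exprn_ge0 // ltW.
  rewrite mulr_natl -sumr_const; apply: ler_sum => S; rewrite inE => Sm.
  rewrite expr1n mulr1 -powR_mulrn ?(ltW q0) // ger_powR //.
  by rewrite q0; lra.
rewrite sum_subsets_binomial addrC.
apply: (@le_trans _ _ (expR q ^+ #|V|)).
  by rewrite lerXn2r ?nnegrE ?expR_ge0 ?expR_ge1Dx //; lra.
have e2 : expR (1 / 4 : R) <= 2.
  have := expR_ge1Dx (- (1 / 4) : R); rewrite expRN.
  move: (expR_gt0 (1 / 4 : R)); move: (expR _) => e e0.
  by rewrite -[leRHS]div1r ler_pdivlMr //; lra.
rewrite -expRM_natr (_ : q * #|V|%:R = 1 / 4 * m); last by rewrite /m; lra.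
by rewrite expRM; apply: ge0_ler_powR; rewrite ?nnegrE ?expR_ge0.
Qed.

Lemma fingerprint_card (q : R) (s : nat) (S : {set V}) : 0 < q < 1 / 8 -> (0 < s)%N ->
  small_fingerprint (q / (16 * s%:R ^+ 2)) q (1 - (16 * s%:R ^+ 2)^-1) (1 / 4) S ->
  #|S|%:R <= 4 * q * #|V|%:R.
Proof.
case/andP=> q0 q8 s0 [i [j [Sij H1 H2]]].
have s1 : 1 <= s%:R ^+ 2 :> R by rewrite exprn_ege1 // ler1n.
have d0 : 0 < (16 * s%:R ^+ 2)^-1 :> R by rewrite invr_gt0; lra.
have d1 : (16 * s%:R ^+ 2)^-1 <= 1 / 16 :> R.
  by rewrite -div1r ler_pdivrMr; lra.
set d := (16 * s%:R ^+ 2)^-1 in H1 d0 d1.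
(* Density and loss share the factor [d], which cancels: the small density costs no more vertices
   than density [q]. *)
have hi : d * i%:R <= 2 * (q * d) * #|V|%:R.
  apply: exponent_le H1; first by apply/andP; split; nra.
    by lra.
  exact: expR_ge1Dx.
have hj : 1 * j%:R <= 2 * q * #|V|%:R.
  apply: exponent_le H2; [by apply/andP; split; lra | by lra | ].
  (* The loss [1 / 4] is at most [expR (- 1)], seen by squaring a bound for [expR (- (1 / 2))]. *)
  have : (1 - 1 / 2) ^+ 2 <= expR (- (1 / 2)) ^+ 2 :> R.
    by rewrite lerXn2r ?nnegrE ?expR_ge0 ?expR_ge1Dx //; lra.
  by rewrite -expRM_natr (_ : - (1 / 2) * 2%:R = - 1 :> R); [rewrite expr2; lra | lra].
have {}hi : i%:R <= 2 * q * #|V|%:R.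
  by rewrite -(ler_pM2l d0); lra.
apply: (@le_trans _ _ (i + j)%:R); first by rewrite ler_nat.
by rewrite natrD; lra.
Qed.

End Counting.

(** * Averaging, arithmetic of the constants, and assembly *)

Lemma imset_transversal (aT rT : finType) (h : aT -> rT) (B : {set aT}) :
  exists G : {set aT}, [/\ G \subset B, {in G &, injective h} & h @: G = h @: B].
Proof.
pose pk y := [pick x in B | h x == y].
exists [set x in B | pk (h x) == Some x]; split.
- by apply/subsetP=> x; rewrite inE => /andP[].
- move=> x x'; rewrite !inE => /andP[_ /eqP ex] /andP[_ /eqP ex'] hx.
  by apply: Some_inj; rewrite -ex -ex' hx.
- apply/setP=> y; apply/imsetP/imsetP => [[x]|[x xB ->]].
    by rewrite inE => /andP[xB _] ->; exists x.
  case E: (pk (h x)) => [x'|]; last first.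
    by move: E; rewrite /pk; case: pickP => // /(_ x); rewrite xB eqxx.
  have [x'B hx'] : x' \in B /\ h x' = h x.
    by move: E; rewrite /pk; case: pickP => // z /andP[zB /eqP hz] [<-].
  by exists x' => //; rewrite inE x'B hx' E eqxx.
Qed.

(** In the random set conditioned to lie in [D], each edge of [G] appears with probability at least
    [(t * b) ^+ k]. The expected mass inside is thus at least [2 * e], and some member of [D]
    reaches [e]. *)
Lemma dense_survivor (R : realFieldType) (V : finType) (t b e : R) (k : nat)
    (D G : {set {set V}}) (S : {set V}) (a : {set V} -> R) :
  0 < t < 1 -> 0 <= b <= 1 -> S \in D -> (forall E, 0 <= a E) -> uniform k G ->
  (forall E, E \in G ->
    b ^+ #|E :\: S| * survival t D S <= survival t D (E :|: S)) ->
  0 < e -> 2 * e <= (t * b) ^+ k * \sum_(E in G) a E ->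
  exists2 A, A \in D & e <= \sum_(E in G | E \subset A) a E.
Proof.
move=> /andP[t0 t1] /andP[b0 b1] SD a0 uG rob e0 le_e.
have t01 : 0 <= t <= 1 by rewrite !ltW.
have tb0 : 0 <= t * b by rewrite mulr_ge0 // ltW.
have tb1 : t * b <= 1 by rewrite mulr_ile1 // ltW.
have Z0 : 0 < survival t D S.
  by apply: lt_le_trans (survival_ge t01 SD); rewrite exprn_gt0 // subr_gt0.
have [/exists_inP[A AD leA]|] :=
    boolP [exists (A | A \in D), e <= \sum_(E in G | E \subset A) a E].
  by exists A.
rewrite negb_exists_in => /forall_inP none; exfalso.
have lo : (t * b) ^+ k * (\sum_(E in G) a E) * survival t D S <=
    \sum_(E in G) a E * \sum_(A in D | S \subset A) samp_weight t S A * (E \subset A)%:R.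
  rewrite [X in X * _ <= _]mulr_sumr mulr_suml; apply: ler_sum => E EG.
  rewrite mulrAC mulrC ler_wpM2l // survival_cond.
  apply: (@le_trans _ _ (t ^+ #|E :\: S| * (b ^+ #|E :\: S| * survival t D S))).
    rewrite mulrA -exprMn ler_wpM2r ?(ltW Z0) // ler_wiXn2l // -(uG E EG).
    by apply: subset_leq_card; apply: subsetDl.
  by rewrite ler_wpM2l ?exprn_ge0 ?(ltW t0) // rob.
have hi : \sum_(E in G) a E *
      \sum_(A in D | S \subset A) samp_weight t S A * (E \subset A)%:R <=
    e * survival t D S.
  rewrite (eq_bigr (fun E => \sum_(A in D | S \subset A)
     a E * (samp_weight t S A * (E \subset A)%:R))); last by move=> E _; rewrite mulr_sumr.
  rewrite exchange_big /= /survival mulr_sumr; apply: ler_sum => A /andP[AD _].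
  rewrite (eq_bigr (fun E => samp_weight t S A * (a E * (E \subset A)%:R))); last first.
    by move=> E _; rewrite mulrCA.
  rewrite -mulr_sumr mulrC ler_wpM2r ?samp_weight_ge0 //.
  rewrite (bigID (fun E : {set V} => E \subset A)) /= [X in _ + X]big1 ?addr0; last first.
    by move=> E /andP[_ /negbTE ->]; rewrite mulr0.
  rewrite (eq_bigr a); last by move=> E /andP[_ ->]; rewrite mulr1.
  by rewrite ltW // ltNge none.
have := le_trans lo hi; rewrite ler_pM2r //; lra.
Qed.

(** Rescaling a part of mass [m] to mass 1 multiplies quadratic sums by [m ^- 2]. The powers of [p]
    and [q] in [eta] pay for this and for the added vertex. *)
Lemma edge_density_arith (Rt : realFieldType) (s r n : nat) (p q R eta m : Rt) :
  (0 < s)%N -> (2 <= r)%N -> (0 < n)%N -> 0 < q -> q < 1 / 8 -> 0 < p ->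
  p <= q / (2 ^+ 10 * r%:R ^+ 2 * s%:R ^+ 2) -> R = 2 ^- 6 * p * n%:R ->
  eta = p ^+ 4 * (q / 2) ^+ (4 * s) -> (q / 4) ^+ s / 8 <= m ->
  m ^- 2 * ((1 + p^-1) * R^-1 + p ^- 2 * (2 ^+ 10 * r%:R * s%:R / n%:R * s%:R))
    <= (4 * (eta * R))^-1.
Proof.
move=> s0 r2 n0 q0 q8 p0 ple -> -> lem.
have nR : 0 < n%:R :> Rt by rewrite ltr0n.
have sR : 1 <= s%:R :> Rt by rewrite ler1n.
have rR : 2 <= r%:R :> Rt by rewrite ler_nat.
have m0 : 0 < m by apply: lt_le_trans lem; rewrite divr_gt0 ?exprn_gt0 ?divr_gt0.
have ss0 : 0 < s%:R :> Rt by lra.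
have [c Hc] : exists c : Rt, c = 2 ^+ 10 by exists (2 ^+ 10).
have c0 : 0 < c by rewrite Hc exprn_gt0.
have c10 : 100 <= c by rewrite Hc -natrX ler_nat.
rewrite -Hc in ple *.
have [y Hy] : exists y : Rt, y = r%:R * s%:R ^+ 2 by exists (r%:R * s%:R ^+ 2).
have s21 : 1 <= s%:R ^+ 2 :> Rt by rewrite exprn_ege1.
have y2 : 2 <= y by rewrite Hy; nra.
have py0 : 0 < p * y by rewrite mulr_gt0 //; lra.
have pcy : c * (p * y) <= 1 / 16.
  move: ple; rewrite ler_pdivlMr; last by rewrite !mulr_gt0 ?exprn_gt0 //; lra.
  rewrite [leLHS](_ : _ = c * (p * y) * r%:R); last by rewrite Hy; ring.
  have := mulr_gt0 c0 py0; move: (c * (p * y)) => z z0 zr.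
  by have := ler_wpM2l (ltW z0) rR; lra.
have pyle : p * y <= 1 / 100.
  move: pcy (ler_wpM2r (ltW py0) c10).
  by move: (c * (p * y)) => w; move: (p * y) => z; lra.
have psmall : p <= 1 / 100.
  by move: pyle (ler_wpM2l (ltW p0) y2); move: (p * y) => z; lra.
pose x := (q / 2) ^+ (4 * s); have x0 : 0 < x by rewrite exprn_gt0 // divr_gt0.
(* Since [q <= 1], the square of [q / 2] is at most [q / 4]. *)
have xm : x <= (8 * m) ^+ 2.
  apply: (@le_trans _ _ (((q / 4) ^+ s) ^+ 2)); last first.
    rewrite lerXn2r ?nnegrE ?mulr_ge0 ?(ltW m0) ?exprn_ge0 ?divr_ge0 ?(ltW q0) //.
    by rewrite [leRHS]mulrC -ler_pdivrMr.
  rewrite -[leRHS]exprM mulnC /x -[(4 * s)%N]/(2 * 2 * s)%N -mulnA exprM.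
  rewrite lerXn2r ?nnegrE ?exprn_ge0 ?divr_ge0 ?(ltW q0) //.
  by rewrite expr2; nra.
rewrite -/x mulrC ler_pdivrMr ?exprn_gt0 //.
rewrite (_ : c * r%:R * s%:R / n%:R * s%:R = c * y / n%:R); last by rewrite Hy; ring.
rewrite (_ : _ + _ = (2 ^+ 6 / (p ^+ 2 * n%:R)) * (1 + p + c / 2 ^+ 6 * y)); last first.
  by field; rewrite !lt0r_neq0.
have den0 : 0 < 4 * (p ^+ 4 * x * (2 ^- 6 * p * n%:R)).
  have p40 : 0 < p ^+ 4 by rewrite exprn_gt0.
  have i60 : 0 < 2 ^- 6 :> Rt by rewrite invr_gt0 exprn_gt0.
  exact: mulr_gt0 (mulr_gt0 (mulr_gt0 p40 x0) (mulr_gt0 (mulr_gt0 i60 p0) nR)).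
rewrite [leRHS]mulrC ler_pdivlMr //.
rewrite [leLHS](_ : _ = (4 * p ^+ 2) * (p + p ^+ 2 + c / 2 ^+ 6 * (p * y)) * x);
  last first.
  by field; rewrite !lt0r_neq0.
suff : (4 * p ^+ 2) * (p + p ^+ 2 + c / 2 ^+ 6 * (p * y)) <= 1 / 64.
  move=> le64; apply: le_trans (ler_wpM2r (ltW x0) le64) _.
  by move: xm; rewrite exprMn; move: (m ^+ 2) => z; rewrite expr2; lra.
have pp : p ^+ 2 <= 1 / 256 by rewrite expr2; nra.
have cpy : c / 2 ^+ 6 * (p * y) <= 1 / 2.
  by rewrite mulrAC; move: pcy; move: (c * _) => w; rewrite !exprS expr0; lra.
have cpy0 : 0 <= c / 2 ^+ 6 * (p * y).
  by rewrite mulr_ge0 ?(ltW py0) // divr_ge0 ?exprn_ge0 ?(ltW c0).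
move: cpy cpy0; move: (_ * (p * y)) => w w1 w0.
have : 0 <= p ^+ 2 by apply: sqr_ge0.
move: (p ^+ 2) pp => z zle z0.
by apply: (@le_trans _ _ (1 / 64 * 1)); [apply: ler_pM; lra | lra].
Qed.

Lemma base_density_01 (Rt : realFieldType) (s : nat) (q : Rt) :
  (0 < s)%N -> 0 < q -> q < 1 / 8 -> 0 < q / (16 * s%:R ^+ 2) < 1.
Proof.
move=> s0 q0 q8; have sR : 1 <= s%:R ^+ 2 :> Rt by rewrite exprn_ege1 // ler1n.
have d0 : 0 < 16 * s%:R ^+ 2 :> Rt by rewrite mulr_gt0 //; lra.
by rewrite divr_gt0 //= ltr_pdivrMr // mul1r; lra.
Qed.

(** Gives both [2 * p <= t1], needed to compare overlaps with [Lambda], and the final bound 1/2 on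
    the total overlap. *)
Lemma base_density_p (Rt : realFieldType) (s r : nat) (p q : Rt) :
  (0 < s)%N -> (2 <= r)%N -> 0 < p -> p <= q / (2 ^+ 10 * r%:R ^+ 2 * s%:R ^+ 2) ->
  p * 2 ^+ 8 <= q / (16 * s%:R ^+ 2).
Proof.
move=> s0 r2 p0; have s2_gt0 : 0 < s%:R ^+ 2 :> Rt by rewrite exprn_gt0 // ltr0n.
have rr : 4 <= r%:R ^+ 2 :> Rt.
  have : 2 <= r%:R :> Rt by rewrite ler_nat.
  by move: (r%:R : Rt) => z z2; rewrite expr2; nra.
have r20 : 0 < r%:R ^+ 2 :> Rt by apply: lt_le_trans rr.
have c0 : 0 < 2 ^+ 10 :> Rt by rewrite exprn_gt0.
rewrite (ler_pdivlMr _ _ (mulr_gt0 (mulr_gt0 c0 r20) s2_gt0)) => ple.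
have d0 : 0 < 16 * s%:R ^+ 2 :> Rt by rewrite mulr_gt0.
rewrite (ler_pdivlMr _ _ d0); apply: (le_trans _ ple).
rewrite [leLHS](_ : _ = p * (2 ^+ 10 * 4 * s%:R ^+ 2)); last by ring.
by rewrite (ler_pM2l p0) (ler_pM2r s2_gt0) (ler_pM2l c0).
Qed.

(** Unifies two cases: for [c' = 0] no measure on [F] is available, all edges are kept and the cone
    alone is Janson; for [c' > 0] the light edges are kept and the two measures are combined. *)
Lemma light_part (Rt : realType) (T : finType) (p c c' e : Rt) (v : T)
    (F K : {set {set T}}) (nu : {set T} -> Rt) :
  0 < p -> 0 < e -> 0 <= c' -> 16 * c' <= c ->
  (forall A, A \in F -> v \notin A) -> janson p c' F ->
  (forall A, A \in K -> v \notin A) -> (forall E, 0 <= nu E) ->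
  e_nu K nu = 1 -> Lambda p K nu <= c^-1 ->
  exists Kg : {set {set T}}, [/\ Kg \subset K, 1 / 2 <= e_nu Kg nu &
    forall (W K' : {set {set T}}) (mu : {set T} -> Rt), K' \subset Kg ->
      F \subset W -> cone v K' \subset W -> (forall E, 0 <= mu E) -> e_nu K' mu = 1 ->
      \sum_(L : {set T} | (2 <= #|L|)%N) d_nu K' mu (L :\ v) ^+ 2 * p ^- #|L|
        <= (4 * e)^-1 ->
      janson p (c' + e) W].
Proof.
move=> p_gt0 e0 c'_ge0 c'c Fv jansonF Kv nu0 e1 LK.
have [c'0|c'n0] := eqVneq c' 0.
  exists K; split=> //; first by rewrite e1; lra.
  move=> W K' mu sK' FW KW mu0 emu LM; rewrite c'0 add0r.
  by apply: janson_cone LM => // A /(subsetP sK')/Kv.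
have c'p : 0 < c' by rewrite lt0r c'n0.
have [ph [ph0 eph Lph]] := janson_normalized p_gt0 c'p jansonF.
exists (light_edges p (2 * c')^-1 F ph K); split.
- by apply/subsetP=> A; rewrite inE => /andP[].
- have := light_edges_mass p_gt0 c'p c'c nu0 ph0 Lph LK.
  by rewrite e1; lra.
move=> W K' mu sK' FW KW mu0 emu LM.
apply: (janson_cone_union e0 c'p Fv _ FW KW mu0 ph0 emu eph Lph _ LM).
- by move=> A /(subsetP sK'); rewrite inE => /andP[/Kv].
- by move=> A /(subsetP sK'); rewrite inE => /andP[].
Qed.

Lemma container_sparse (Rt : realType) (s r n : nat) (p q R R' eta : Rt)
    (T V : finType) (F : {set {set T}}) (H : {set {set V}}) (pi : V -> T) (v : T)
    (D : {set {set V}}) (X : {set V}) :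
  (0 < s)%N -> (2 <= r)%N -> (0 < n)%N -> 0 < q -> q < 1 / 8 -> 0 < p ->
  p <= q / (2 ^+ 10 * r%:R ^+ 2 * s%:R ^+ 2) -> R = 2 ^- 6 * p * n%:R ->
  0 <= R' -> 16 * R' <= R -> eta = p ^+ 4 * (q / 2) ^+ (4 * s) ->
  (forall A, A \in F -> v \notin A) -> janson p R' F ->
  uniform s H -> #|V| = n -> (forall x, pi x != v) ->
  (forall L : {set V}, (#|L| <= 2 * #|pi @: L|)%N) ->
  (forall E, E \in H -> #|pi @: E| = #|E|) ->
  (forall I, I \in D ->
    ~ janson p (R' + eta * R) (hproj_v pi v (sub_hgraph H I) :|: F)) ->
  is_container (q / (16 * s%:R ^+ 2)) q (1 - (16 * s%:R ^+ 2)^-1) (1 / 4) D X ->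
  exists Y : {set V}, [/\ Y \subset X,
    #|X|%:R - n%:R / (2 ^+ 8 * r%:R) <= #|Y|%:R :> Rt &
    ~ janson p R (hproj pi (sub_hgraph H Y))].
Proof.
move=> s_gt0 r_ge2 n_gt0 q_gt0 q_lt p_gt0 p_le R_def R'_ge0 R'_le eta_def Fv jansonF.
move=> unifH cardV piv fiber2 injH Dbad [S [D' [sD' dD' [SD' stab1 stab2] eqX]]].
apply: contrapT => noY.
have nR : 0 < n%:R :> Rt by rewrite ltr0n.
have R_gt0 : 0 < R by rewrite R_def mulr_gt0 // mulr_gt0 // invr_gt0 exprn_gt0.
have eta_gt0 : 0 < eta by rewrite eta_def mulr_gt0 ?exprn_gt0 // divr_gt0.
have etaR_gt0 : 0 < eta * R by rewrite mulr_gt0.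
have t01 := base_density_01 s_gt0 q_gt0 q_lt.
have pt := base_density_p s_gt0 r_ge2 p_gt0 p_le.
set t1 := q / _ in stab1 t01 pt.
have jan (Y : {set V}) : Y \subset X ->
    #|X|%:R - #|V|%:R / (2 ^+ 8 * r%:R) <= #|Y|%:R :> Rt ->
    janson p R (hproj pi (sub_hgraph H Y)).
  by rewrite cardV => YX Yc; apply: contrapT => nj; apply: noY; exists Y.
have [] := spread_measure p_gt0 R_gt0 s_gt0 (ltnW r_ge2) unifH injH fiber2 _ jan.
  by rewrite cardV.
set K := hproj pi (sub_hgraph H X) => nu [nu0 enu Lnu dnu].
have Kv A : A \in K -> v \notin A 
  by case/imsetP=> E _ ->; apply/imsetP=> -[x _ /eqP]; rewrite eq_sym (negbTE (piv x)).
have [Kg [sKg eKg janK]] := light_part p_gt0 etaR_gt0 R'_ge0 R'_le Fv jansonF Kv nu0 enu Lnu.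
(* One preimage edge is chosen for each projected edge, so that [nu] lifts to [G] without counting
   any mass twice. *)
have [G [sG injG imG]] := imset_transversal (fun E : {set V} => pi @: E)
  [set E in sub_hgraph H X | pi @: E \in Kg].
have {}imG : hproj pi G = Kg.
  rewrite /hproj imG; apply/setP=> A; apply/imsetP/idP => [[E]|AKg].
    by rewrite inE => /andP[_ ?] ->.
  have /imsetP[E EH eqA] := subsetP sKg A AKg.
  by exists E => //; rewrite inE EH -eqA.
have GP E : E \in G -> [/\ E \in H, E \subset X & pi @: E \in Kg].
  by move/(subsetP sG); rewrite !inE => /andP[/andP[]].
pose a (E : {set V}) := nu (pi @: E).
have a0 E : 0 <= a E by apply: nu0.
pose Gx := [set E in G | E :|: S \notin D'].
pose Gok := [set E in G | E :|: S \in D'].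
have massG : 1 / 2 <= \sum_(E in Gok) a E + \sum_(E in Gx) a E.
  apply: le_trans eKg _; rewrite -imG /e_nu /hproj big_imset //=.
  rewrite (bigID (fun E => E :|: S \in D')) /= le_eqVlt; apply/orP; left; apply/eqP.
  by congr (_ + _); apply: eq_bigl => E; rewrite inE.
have inG (B : {set {set V}}) : B \subset G ->
    [/\ uniform s B, {in B &, injective (fun E : {set V} => pi @: E)},
        forall E, E \in B -> #|pi @: E| = #|E| & hproj pi B \subset Kg].
  move=> sB; split.
  - by move=> E /(subsetP sB)/GP[EH _ _]; apply: unifH.
  - by move=> E E' /(subsetP sB) EG /(subsetP sB) EG'; apply: injG.
  - by move=> E /(subsetP sB)/GP[EH _ _]; apply: injH.
  - by rewrite -imG imsetS.
have sGx : Gx \subset G by apply/subsetP=> E; rewrite inE => /andP[].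
have sGok : Gok \subset G by apply/subsetP=> E; rewrite inE => /andP[].
have massGx : \sum_(E in Gx) a E <= 1 / 4.
  have [uGx iGx cGx hGx] := inG _ sGx.
  apply: (excluded_mass_le t01 s_gt0 dD' SD' a0 uGx).
  - by move=> E; rewrite inE => /andP[].
  (* A vertex of an edge inside [X] may be added to [S] within [D'], so stability applies to it. *)
  - move=> E y /(subsetP sGx)/GP[_ /subsetP EX _] /EX.
    by rewrite eqX inE => /stab1.
  have le2p : 2 * p <= t1 by apply: le_trans pt; rewrite mulrC ler_pM2l // -natrX ler_nat.
  have := overlap_le_Lambda p_gt0 le2p nu0 cGx iGx.
  move/(ler_wpM2l (ltW nR)); rewrite cardV => /le_trans; apply.
  have t10 : 0 < t1 by case/andP: t01.
  have cc0 : 0 <= 2 * p ^+ 2 / t1.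
    by apply: divr_ge0; [apply: mulr_ge0; rewrite ?sqr_ge0 | apply: ltW].
  apply: (@le_trans _ _ (n%:R * (2 * p ^+ 2 / t1 * R^-1))).
    rewrite ler_wpM2l ?(ltW nR) // ler_wpM2l //.
    by apply: (le_trans _ Lnu); apply: Lambda_sub => //; apply: subset_trans sKg.
  (* The value of [R] cancels [n], and [t1] is at least [2 ^+ 8 * p]. *)
  rewrite (_ : n%:R * _ = p * 2 ^+ 7 / t1); last first.
    by rewrite R_def; field; rewrite !lt0r_neq0.
  rewrite ler_pdivrMr //; move: pt; rewrite (exprS 2 7).
  by move=> {}pt; clear -pt; move: (2 ^+ 7) pt => z; lra.
have massGok : 1 / 4 <= \sum_(E in Gok) a E by move: massG massGx; clear; lra.
have [uGok iGok cGok hGok] := inG _ sGok.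
have [A AD' massA] : exists2 A, A \in D' &
    (q / 4) ^+ s / 8 <= \sum_(E in Gok | E \subset A) a E.
  apply: (@dense_survivor _ _ q (1 / 4) _ s D' Gok S a) => //.
  - by rewrite q_gt0 (lt_trans q_lt) //; clear; lra.
  - by apply/andP; split; clear; lra.
  - by move=> E; rewrite inE => /andP[_ /stab2].
  - by rewrite divr_gt0 ?exprn_gt0 ?divr_gt0.
  rewrite (_ : q * (1 / 4) = q / 4); last by rewrite mul1r.
  rewrite (_ : 2 * _ = (q / 4) ^+ s * (1 / 4)); last by field.
  by rewrite ler_wpM2l // exprn_ge0 // divr_ge0 // ltW.
pose B := [set E in Gok | E \subset A].
have sB : B \subset G by apply: subset_trans sGok; apply/subsetP=> E;
  rewrite inE => /andP[].
have [uB iB cB hB] := inG _ sB.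
have m_def : e_nu (hproj pi B) nu = \sum_(E in Gok | E \subset A) a E.
  by rewrite /e_nu /hproj big_imset //=; apply: eq_bigl => E; rewrite inE.
move: massA; rewrite -m_def; set m := e_nu _ _ => massA.
have m0 : 0 < m by apply: lt_le_trans massA; rewrite divr_gt0 ?exprn_gt0 ?divr_gt0.
(* [A] is bad, yet the edges of [B] lie in [A], and [nu] on their projections, rescaled to mass 1,
   makes the union with [F] Janson. *)
apply: (Dbad A (subsetP sD' _ AD')).
apply: (janK _ (hproj pi B) (fun E => m^-1 * nu E) hB).
- exact: subsetUr.
- apply/subsetP=> _ /imsetP[_ /imsetP[E EB ->] ->]; rewrite inE; apply/orP; left.
  apply: imset_f; move: EB; rewrite inE => /andP[/(subsetP sGok)/GP[EH _ _] EA].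
  by rewrite inE EH.
- by move=> E; rewrite mulr_ge0 // invr_ge0 ltW.
- by rewrite e_nuZ mulVf // lt0r_neq0.
have := edge_density_arith s_gt0 r_ge2 n_gt0 q_gt0 q_lt p_gt0 p_le R_def eta_def massA.
apply: le_trans.
under eq_bigr do rewrite d_nuZ exprMn -mulrA.
rewrite -mulr_sumr exprVn ler_wpM2l ?invr_ge0 ?sqr_ge0 //.
apply: le_trans (Lambda_cone_le _ p_gt0 _ nu0) _.
have sBK : hproj pi B \subset K by apply: subset_trans sKg.
apply: lerD.
  rewrite ler_wpM2l ?addr_ge0 ?invr_ge0 ?(ltW p_gt0) //.
  by apply: (le_trans _ Lnu); apply: Lambda_sub.
rewrite ler_wpM2l ?invr_ge0 ?sqr_ge0 //.
(* The squared degrees are bounded by the maximal degree times the sum of degrees, which is [s] by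
   uniformity. *)
apply: (@le_trans _ _ (\sum_u (2 ^+ 10 * r%:R * s%:R / n%:R) * d_nu K nu [set u])).
  apply: ler_sum => u _; rewrite expr2; apply: ler_pM; rewrite ?d_nu_ge0 ?d_nu_sub //.
  by apply: le_trans (d_nu_sub _ nu0 sBK) _; rewrite -cardV.
rewrite -mulr_sumr (@sum_d_nu1 _ _ s) ?enu ?mulr1 //.
exact: uniform_hproj.
Qed.

Theorem theorem5p4 (Rt : realType) (s r n : nat) (p q R R' eta : Rt)
  (T V : finType) (U : {set T}) (F : {set {set T}}) (H : {set {set V}})
  (pi : V -> T) (v : T) :
  (s <= n)%N -> (2 <= r)%N ->
  0 < q -> q < 1 / 8 ->
  0 < p -> p <= q / (2 ^+ 10 * r%:R ^+ 2 * s%:R ^+ 2) ->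
  R = 2 ^- 6 * p * n%:R ->
  0 <= R' -> R' <= R / 16 ->
  eta = p ^+ 4 * (q / 2) ^+ (4 * s) ->
  (* F : (s+1)-uniform, vertex set U, (p,R')-Janson *)
  (forall E, E \in F -> E \subset U) ->
  uniform (s.+1) F ->
  janson p R' F ->
  (* H : s-uniform on V, |V| = n *)
  uniform s H ->
  #|V| = n ->
  (* pi : V -> U *)
  (forall x, pi x \in U) ->
  (forall L : {set V}, (#|L| <= 2 * #|pi @: L|)%N) ->
  (forall E, E \in H -> #|pi @: E| = #|E|) ->
  v \notin U ->
  exists X : {set {set V}},
    [/\ (#|X|%:R <= 4 * (2 / q) `^ (4 * q * n%:R)),
        (forall I : {set V},
            ~ janson p (R' + eta * R) (hproj_v pi v (sub_hgraph H I) :|: F) ->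
            exists2 X0, X0 \in X & I \subset X0) &
        (forall X0, X0 \in X -> (n%:R / (8 * r%:R) : Rt) <= #|X0|%:R ->
            exists Y : {set V},
              [/\ Y \subset X0,
                  (#|X0|%:R - n%:R / (2 ^+ 8 * r%:R) : Rt) <= #|Y|%:R &
                  ~ janson p R (hproj pi (sub_hgraph H Y))])].
Proof.
move=> s_le_n r_ge2 q_gt0 q_lt p_gt0 p_le R_def R'_ge0 R'_le eta_def F_sub _ jansonF.
move=> unifH cardV pi_U fiber2 injH v_notin.
(* Division by zero yields 0, so for [s = 0] the upper bound on [p] would contradict [0 < p]. *)
have s_gt0 : (0 < s)%N.
  rewrite lt0n; apply: contraTneq p_le => ->.
  by rewrite expr0n mulr0 invr0 mulr0 -ltNge.
have n_gt0 : (0 < n)%N by apply: leq_trans s_le_n.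
have Fv A : A \in F -> v \notin A.
  by move=> /F_sub/subsetP sA; apply: contra v_notin => /sA.
have piv x : pi x != v by apply: contraNneq v_notin => <-.
have R'16 : 16 * R' <= R by rewrite mulrC -ler_pdivlMr.
have s2_ge1 : 1 <= s%:R ^+ 2 :> Rt by rewrite exprn_ege1 // ler1n.
have d_gt0 : 0 < 16 * s%:R ^+ 2 :> Rt by apply: mulr_gt0 => //; clear -s2_ge1; lra.
have b1_01 : 0 <= 1 - (16 * s%:R ^+ 2 : Rt)^-1 <= 1.
  rewrite subr_ge0 gerBl invr_ge0 (ltW d_gt0) andbT invf_le1 //.
  by clear -s2_ge1; lra.
have q01 : 0 <= q <= 1 by rewrite ltW //= ltW // (lt_trans q_lt) //; clear; lra.
have t01 : 0 <= q / (16 * s%:R ^+ 2) <= 1.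
  by have /andP[/ltW -> /ltW ->] := base_density_01 s_gt0 q_gt0 q_lt.
pose bad (I : {set V}) :=
  ~ janson p (R' + eta * R) (hproj_v pi v (sub_hgraph H I) :|: F).
pose D := [set I : {set V} | `[< bad I >]].
have dD : downset D.
  move=> A B; rewrite !inE => /asboolP badB AB; apply/asboolP => janA; apply: badB.
  apply: janson_sub janA; apply: setSU; apply: imsetS.
  by apply/subsetP=> E; rewrite !inE => /andP[-> /subset_trans]; apply.
have b2_ge0 : 0 <= 1 / 4 :> Rt by clear; lra.
have card0 : (#|set0 : {set V}| <= 0 + 0)%N by rewrite cards0.
have [f fP] := container_algorithm t01 q01 b1_01 b2_ge0 dD card0
  (survival0_le1 _ t01) (survival0_le1 _ q01).
pose fingerprint (S : {set V}) :=
  small_fingerprint (q / (16 * s%:R ^+ 2)) q (1 - (16 * s%:R ^+ 2)^-1) (1 / 4) S.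
pose container := is_container (q / (16 * s%:R ^+ 2)) q (1 - (16 * s%:R ^+ 2)^-1) (1 / 4) D.
(* The function [f] is controlled only at fingerprints that the algorithm returns, so the family
   keeps just the [S] with both properties. *)
exists [set f S | S : {set V} in [set S | `[< fingerprint S /\ container (f S) >]]];
  split.
- have q018 : 0 < q < 1 / 8 by rewrite q_gt0.
  apply: (@le_trans _ _ ((2 / q) `^ (4 * q * n%:R))); last first.
    by rewrite ler_peMl ?powR_ge0 ?ler1n.
  rewrite -cardV; apply: le_trans (count_small_sets V q018); rewrite ler_nat.
  apply: leq_trans (leq_imset_card _ _) _; apply: subset_leq_card.
  apply/subsetP=> S; rewrite !inE => /asboolP[fpS _].
  exact: fingerprint_card fpS.
- move=> I badI; have [|S [_ _ fpS IfS cS]] := fP I _ (sub0set I).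
    by rewrite inE; apply/asboolP.
  by exists (f S) => //; apply: imset_f; rewrite inE; apply/asboolP.
- move=> _ /imsetP[S + ->] _; rewrite inE => /asboolP[_ cS].
  have Dbad I : I \in D -> bad I by rewrite inE => /asboolP.
  exact: (container_sparse s_gt0 r_ge2 n_gt0 q_gt0 q_lt p_gt0 p_le R_def R'_ge0 R'16
    eta_def Fv jansonF unifH cardV piv fiber2 injH Dbad cS).
Qed.
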